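(* There exists $N\in\mathbb{N}$ such that for any finite symmetric set $S\subset \mathrm{SA}(2,\mathbb{Z})$ containing $1$ and generating a non-virtually solvable subgroup $\Gamma$ which does not have a global fixed point in $\mathbb{Q}^2$, there exist $a,b\in S^N$ such that the plane $\mathbb{R}^2$ is $(\{1,a,b\},4)$-paradoxical.
   Context: $\mathrm{SA}(2,\mathbb{Z})=\mathrm{SL}(2,\mathbb{Z})\ltimes\mathbb{Z}^2$, acting on $\mathbb{R}^2$ by affine transformations $gx=\theta(g)x+\tau(g)$, where $\theta(g)$ is the linear part and $\tau(g)$ the translation part. $S$ is symmetric if $S^{-1}=S$, and $S^N=\{s_1\cdots s_N : s_i\in S\}$. Paradoxical sets: let a group $G$ act on a set $X$, let $E\subseteq X$ and $T\subseteq G$. $E$ is $(T,n+m)$-paradoxical if there exist a finite index set $\mathcal{I}$ with a partition $\mathcal{I}=\mathcal{I}_1\sqcup\mathcal{I}_2$, $|\mathcal{I}_1|=n$, $|\mathcal{I}_2|=m$, elements $g_i\in T$ and pairwise disjoint subsets $A_i\subset E$ ($i\in\mathcal{I}$) such that $E=\bigcup_{i\in\mathcal{I}_1}g_iA_i=\bigcup_{i\in\mathcal{I}_2}g_iA_i$. $E$ is $(T,r)$-paradoxical if it is $(T,n+m)$-paradoxical for some $n,m$ with $n+m=r$. Here the pieces $A_i$ are arbitrary subsets of $\mathbb{R}^2$ (no measurability is required). *)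

(* Defs.v *)
From HB Require Import structures.
From mathcomp Require Import all_boot all_order all_algebra.
From mathcomp Require Import all_classical all_reals.

Set Implicit Arguments.
Unset Strict Implicit.
Unset Printing Implicit Defensive.

Import GRing.Theory.

Local Open Scope classical_set_scope.
Local Open Scope ring_scope.

(** [SA2Z] is infinite, so subgroups cannot be those of [fingroup]: they are
    classical sets of elements of a [groupType]. *)

Section GroupSets.
Variable G : groupType.
Implicit Types (S H K : set G) (N : nat).

Definition symmetric_gset S : Prop := [set x^-1%g | x in S] = S.

(** S^N is the N-fold product set, not the set of N-th powers. *)
Definition gset_pow S N : set G :=
  [set (\prod_(i < N) s i)%g | s in [set s : 'I_N -> G | forall i, S (s i)]].

Definition is_subgroup H : Prop :=
  H 1%g /\ forall x y, H x -> H y -> H (x * y^-1)%g.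

Definition generated_subgroup S : set G := smallest is_subgroup S.

Definition derived_subgroup H : set G :=
  generated_subgroup [set [~ x, y]%g | x in H & y in H].

Definition solvable_subgroup H : Prop :=
  exists n, iter n derived_subgroup H = [set 1%g].

Definition left_cosets K H : set (set G) :=
  [set [set (x * k)%g | k in K] | x in H].

Definition virtually_solvable H : Prop :=
  exists K, [/\ is_subgroup K, K `<=` H, finite_set (left_cosets K H)
              & solvable_subgroup K].

End GroupSets.

Record group_action (G : groupType) (X : Type) := GroupAction {
  act_fun :> G -> X -> X;
  act_fun1 : forall x, act_fun 1%g x = x;
  act_funM : forall g h x, act_fun (g * h)%g x = act_fun g (act_fun h x)
}.

Section Paradoxical.
Variables (G : groupType) (X : Type) (act : group_action G X).
Implicit Types (T : set G) (E : set X) (n m r : nat).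

Definition fixed_by (H : set G) (x : X) : Prop := forall g, H g -> act g x = x.

Definition paradoxical2 T n m E : Prop :=
  exists (I : finType) (I1 I2 : {set I}) (g : I -> G) (A : I -> set X),
    [/\ (I1 :|: I2)%SET = [set: I]%SET, (I1 :&: I2)%SET = finset.set0,
        #|I1| = n & #|I2| = m] /\
    [/\ forall i, T (g i),
        forall i, A i `<=` E,
        trivIset [set: I] A,
        E = \bigcup_(i in [set` I1]) (act (g i) @` A i)
      & E = \bigcup_(i in [set` I2]) (act (g i) @` A i)].

Definition paradoxical T r E : Prop :=
  exists n m, (n + m)%N = r /\ paradoxical2 T n m E.

End Paradoxical.

(** The pair (A, v) stands for the affine map x |-> A x + v. *)
Record SA2Z := MkSA2Z {
  SA_pair : 'M[int]_2 * 'cV[int]_2;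
  SA_det : \det SA_pair.1 == 1
}.

HB.instance Definition _ := [isSub for SA_pair].
HB.instance Definition _ := [Choice of SA2Z by <:].

Definition theta (g : SA2Z) : 'M[int]_2 := (SA_pair g).1.
Definition tau (g : SA2Z) : 'cV[int]_2 := (SA_pair g).2.

Lemma det_theta g : \det (theta g) = 1.
Proof. exact/eqP/SA_det. Qed.

Lemma SA2Z_eq g h : theta g = theta h -> tau g = tau h -> g = h.
Proof.
by move=> e1 e2; apply: val_inj; rewrite /= [LHS]surjective_pairing
  [RHS]surjective_pairing; congr pair.
Qed.

Lemma theta_unit g : theta g \in unitmx.
Proof. by rewrite unitmxE det_theta unitr1. Qed.

Fact SA_one_det : \det (1%:M : 'M[int]_2) == 1.
Proof. by rewrite det1. Qed.

Fact SA_mul_det g h : \det (theta g *m theta h) == 1.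
Proof. by rewrite det_mulmx !det_theta mulr1. Qed.

Fact SA_inv_det g : \det (invmx (theta g)) == 1.
Proof. by rewrite det_inv det_theta invr1. Qed.

Definition SA_one : SA2Z := @MkSA2Z (1%:M, 0) SA_one_det.

Definition SA_mul (g h : SA2Z) : SA2Z :=
  @MkSA2Z (theta g *m theta h, theta g *m tau h + tau g) (SA_mul_det g h).

Definition SA_inv (g : SA2Z) : SA2Z :=
  @MkSA2Z (invmx (theta g), - (invmx (theta g) *m tau g)) (SA_inv_det g).

Fact SA_mulA : associative SA_mul.
Proof.
move=> f g h; apply: SA2Z_eq; rewrite /theta /tau /= -/(theta _) -/(tau _).
  by rewrite mulmxA.
by rewrite mulmxDr mulmxA addrA.
Qed.

Fact SA_mul1 : left_id SA_one SA_mul.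
Proof.
by move=> g; apply: SA2Z_eq; rewrite /theta /tau /= -/(theta _) -/(tau _)
  mul1mx ?addr0.
Qed.

Fact SA_mul1r : right_id SA_one SA_mul.
Proof.
by move=> g; apply: SA2Z_eq; rewrite /theta /tau /= -/(theta _) -/(tau _)
  ?mulmx1 // mulmx0 add0r.
Qed.

Fact SA_mulV : left_inverse SA_one SA_inv SA_mul.
Proof.
move=> g; apply: SA2Z_eq; rewrite /theta /tau /= -/(theta _) -/(tau _).
  by rewrite mulVmx ?theta_unit.
by rewrite subrr.
Qed.

Fact SA_mulVr : right_inverse SA_one SA_inv SA_mul.
Proof.
move=> g; apply: SA2Z_eq; rewrite /theta /tau /= -/(theta _) -/(tau _).
  by rewrite mulmxV ?theta_unit.
by rewrite mulmxN mulmxA mulmxV ?theta_unit // mul1mx addNr.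
Qed.

HB.instance Definition _ :=
  isGroup.Build SA2Z SA_mulA SA_mul1 SA_mul1r SA_mulV SA_mulVr.

Section Plane.
Variable R : realType.

Definition affine_map (g : SA2Z) (x : 'cV[R]_2) : 'cV[R]_2 :=
  map_mx intr (theta g) *m x + map_mx intr (tau g).

Fact affine_map1 x : affine_map 1%g x = x.
Proof. by rewrite /affine_map map_mx1 map_mx0 mul1mx addr0. Qed.

Fact affine_mapM g h x :
  affine_map (g * h)%g x = affine_map g (affine_map h x).
Proof.
by rewrite /affine_map map_mxD !map_mxM mulmxDr mulmxA addrA.
Qed.

Definition affine_action : group_action SA2Z 'cV[R]_2 :=
  GroupAction affine_map1 affine_mapM.

Definition rational_points : set 'cV[R]_2 :=
  range (fun q : 'cV[rat]_2 => map_mx ratr q).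

End Plane.

(* Main.v *)
Require Import Defs.
From mathcomp Require Import all_boot all_order all_algebra.
From mathcomp Require Import all_classical all_reals.
From mathcomp Require Import ring lra zify.

(** The plane has a four-piece paradox with translating elements 1, a, b as
    soon as the Schreier graph of the two maps a and b, with an edge from x to
    a x and one from x to b x for each point x, can be oriented so that every
    point has in-degree at most one: the pieces are the sets of points whose
    incoming edge carries a given label among a, a^-1, b, b^-1.

    Such an orientation exists when the points carry a height for which, above
    some level, at most one of the four neighbours of a point is not strictly
    higher, and, below that level, at most two of the four neighbours stay
    below it ([orientation]).  Edges reaching the high part point to their
    higher end; the low part is a disjoint union of paths and cycles, and each
    of them is oriented consistently by choice ([alternating_set]).

    The sup norm in a suitable frame of the plane is such a height when a and b
    are hyperbolic affine maps with distinct fixed points P_a, P_b in general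
    position: each eigendirection of a is transverse to those of b, and all
    four to the direction from P_a to P_b, up to a factor K, while the
    eigenvalue is at least K^7 ([high_expands], [low_expands]).  A letter that
    fails to raise a point forces one eigencoordinate of that point to be tiny.
    Two tiny eigencoordinates bring the point near P_a, near P_b, or near one
    of the four intersections of eigenlines, hence in the low part; three bring
    it near P_a or P_b and near an eigenline of the other map at once, which
    general position excludes.

    General position holds with a K that depends only on the eigenvalue.  Start
    with an integral hyperbolic g, of eigenvalue l and fixed point o, and with
    k such that k moves o and such that k g k^-1 has linear part different from
    those of g and g^-1.  In an eigenframe of g, write k' for the matrix of k.
    The numbers k'_01 k'_10 and k'_00 k'_11, multiplied by (l - 1/l)^2, are
    nonzero integers ([commutator_det_neq0], [inversion_det_neq0]): this
    discreteness bounds by powers of l the ratio of the slopes of the two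
    eigenlines of k g k^-1.  The direction from o to k o lies on no eigenline
    of g, because a rational vector is never an eigenvector, but nothing bounds
    its slope.  One therefore takes a = k g^70 k^-1 and b = g^d a g^-d:
    conjugating by g^d moves all slopes by powers of l^d, and one of the three
    values d = 5, 6, 7 avoids every resonance ([good_exponent]).

    Finally g and k are words of bounded length in S.  Two elements of S with
    noncommuting linear parts exist, and either the first one or their
    commutator is hyperbolic ([commutator_hyperbolic]).  The elements that
    preserve the pair of axes of g form a solvable group, and those fixing o
    form a proper subgroup by the absence of a global rational fixed point; a
    product of at most two elements of S lies outside both
    ([short_outside]). *)

Set Implicit Arguments.
Unset Strict Implicit.
Unset Printing Implicit Defensive.

Import Order.TTheory GRing.Theory Num.Theory.

Local Open Scope classical_set_scope.
Local Open Scope ring_scope.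

(** * Orientations and four-piece paradoxes *)

Section AlternatingSet.
Variables (T : Type) (f g : T -> T).
Hypotheses (ff : involutive f) (gg : involutive g).
Hypotheses (f_free : forall x, f x <> x) (g_free : forall x, g x <> x).

Let h x := g (f x).
(* Being in the same orbit of [h], through forward iterates of both points. *)
Let same x y := exists m n, iter m h x = iter n h y.

Let iter_reflect n x : iter n h (f (iter n h x)) = f x.
Proof.
elim: n x => // n IHn x; rewrite iterSr iterS -[RHS]IHn; congr (iter n h _).
by rewrite /h ff gg.
Qed.

Let iter_neq_reflect n x : iter n h x <> f x.
Proof.
suff P m : (forall x, iter m h x <> f x) /\ (forall x, iter m.+1 h x <> f x).
  by case: (P n).
elim: m => [|m [IH1 IH2]]; split => //.
- by move=> y /esym; apply: f_free.
- by move=> y /g_free.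
- move=> y e; apply: (IH1 (h y)).
  have: f (g (iter m.+2 h y)) = f (g (f y)) by rewrite e.
  by rewrite iterS /h gg ff -/(h _) -iterSr.
Qed.

Let h_inj : injective h.
Proof. by move=> x y /(inv_inj gg) /(inv_inj ff). Qed.

Let iter_inj n : injective (iter n h).
Proof. by elim: n => // n IHn x y /h_inj/IHn. Qed.

Let same_neq_reflect x : ~ same x (f x).
Proof.
case=> m [n]; case: (leqP n m) => [le_nm|/ltnW le_mn].
  rewrite -(subnKC le_nm) iterD => /iter_inj.
  exact: iter_neq_reflect.
rewrite -(subnKC le_mn) iterD => /iter_inj/esym e.
by apply: (@iter_neq_reflect (n - m) (f x)); rewrite e ff.
Qed.

Let same_sym x y : same x y -> same y x.
Proof. by case=> m [n e]; exists n, m. Qed.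

Let same_trans x y z : same x y -> same y z -> same x z.
Proof.
case=> m [n e] [m' [n' e']]; exists (m' + m)%N, (n + n')%N.
by rewrite iterD e -iterD addnC iterD e' -iterD.
Qed.

Let same_reflect x y : same x y -> same (f x) (f y).
Proof.
case=> m [n e]; exists n, m.
by rewrite -(iter_reflect m x) -(iter_reflect n y) e -!iterD addnC.
Qed.

(** The two involutions generate an action of the infinite dihedral group.  A
    reflection is conjugate to [f] or to [g], so none has a fixed point, and
    every orbit splits into two classes under the rotations [h ^ n]; choosing
    one class in each orbit gives the set. *)
Lemma alternating_set :
  exists D : set T, forall x, (D (f x) <-> ~ D x) /\ (D (g x) <-> ~ D x).
Proof.
have [[x0 _]|noT] := pselect (exists x : T, True); last first.
  by exists set0 => x; case: noT; exists x.
pose orbit x := [set y | same x y \/ same x (f y)].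
have same_refl x : same x x by exists 0%N, 0%N.
have orbit_same x y : same x y -> orbit x = orbit y.
  move=> xy; have yx := same_sym xy.
  by apply/seteqP; split=> z [] ?; [left|right|left|right];
    apply: same_trans; eassumption.
have orbit_f x : orbit (f x) = orbit x.
  by apply/seteqP; split=> z [] /same_reflect;
    rewrite ?ff => ?; [right|left|right|left].
have same_gf x : same (g x) (f x) by exists 0%N, 1%N; rewrite /= /h ff.
have ex_point (A : set T) : exists y, A !=set0 -> A y.
  by have [[y Ay]|nA] := pselect (A !=set0); [exists y|exists x0].
have [c cP] := boolp.choice ex_point.
pose rep x := c (orbit x).
have rep_orbit x : orbit x (rep x) by apply: cP; exists x; left.
pose D := [set x | same x (rep x)].
have Df x : D (f x) <-> ~ D x.
  rewrite /D /= /rep orbit_f -/(rep x); split=> [fxr xr|nxr].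
    by apply: (@same_neq_reflect x); apply: same_trans xr (same_sym fxr).
  by case: (rep_orbit x) => // /same_reflect; rewrite ff.
exists D => x; split=> //; rewrite -Df /D /= /rep (orbit_same _ _ (same_gf x)).
by split; apply: same_trans => //; apply: same_sym.
Qed.

End AlternatingSet.

(** The first component tells [a] from [b]; the second is true for the
    generator and false for its inverse. *)
Definition letter := (bool * bool)%type.
Definition inv_letter (s : letter) : letter := (s.1, ~~ s.2).

Lemma inv_letterK : involutive inv_letter.
Proof. by case=> i j; rewrite /inv_letter /= negbK. Qed.

Section Orientation.
Variables (R : realDomainType) (X : Type) (step : letter -> X -> X).
Hypothesis stepK : forall s, cancel (step s) (step (inv_letter s)).
Variables (nu : X -> R) (L : R).
Hypothesis high : forall x s t, L < nu x -> s != t ->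
  nu (step s x) <= nu x -> nu (step t x) <= nu x -> False.
Hypothesis low : forall x s t u, nu x <= L -> uniq [:: s; t; u] ->
  nu (step s x) <= L -> nu (step t x) <= L -> nu (step u x) <= L -> False.

Let inner x s := (nu x <= L) && (nu (step s x) <= L).

Let inner_inv x s : inner (step s x) (inv_letter s) = inner x s.
Proof. by rewrite /inner stepK andbC. Qed.

Let other x s := [pick t | (t != s) && inner x t].

Let other_sym x s t : inner x s -> other x s = Some t ->
  [/\ other x t = Some s, inner x t & t != s].
Proof.
move=> xs; rewrite /other; case: pickP => // t' /andP[ne xt'] [<-{t}].
split=> //; case: pickP => [u /andP[ne' xu]|/(_ s)].
  congr Some; apply/eqP/negPn/negP => us.
  case/andP: xs => x_low xs; case/andP: xt' => _ xt'; case/andP: xu => _ xu.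
  apply: (low x_low _ xs xt' xu).
  by rewrite /= !inE negb_or eq_sym ne eq_sym us eq_sym ne'.
by rewrite eq_sym ne xs.
Qed.

(* A dart is an edge with a chosen end, duplicated by a boolean: the two copies
   of a path of low points are glued at its loose ends, which makes [flip] and
   [swap] total without fixed points. *)
Let dart := ((X * letter) * bool)%type.

Let flip (e : dart) : dart :=
  let: (x, s, i) := e in
  if inner x s then (step s x, inv_letter s, i) else (x, s, ~~ i).

Let swap (e : dart) : dart :=
  let: (x, s, i) := e in
  if inner x s then
    if other x s is Some t then (x, t, i) else (x, s, ~~ i)
  else (x, s, ~~ i).

(** [W s x] means that the edge joining [x] to [step s x] points to [x].  In the
    low part the orientation alternates under passing to the other end of an
    edge ([flip]) and to the other low edge at a point ([swap]). *)
Lemma orientation : exists W : letter -> set X,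
  (forall x s t, W s x -> W t x -> s = t) /\
  (forall x s, W s x \/ W (inv_letter s) (step s x)).
Proof.
have flipK : involutive flip.
  move=> [[x s] i]; rewrite /flip; case: ifP => xs.
    by rewrite inner_inv xs stepK inv_letterK.
  by rewrite xs negbK.
have swapK : involutive swap.
  move=> [[x s] i]; rewrite /swap; case: ifP => xs; last by rewrite xs negbK.
  case xst: (other x s) => [t|]; last by rewrite xs xst negbK.
  by have [-> -> _] := other_sym xs xst.
have neg_neq (i : bool) : ~~ i <> i by case: i.
have inv_neq s : inv_letter s <> s by case: s => i j [] /neg_neq.
have flip_free e : flip e <> e.
  case: e => [[x s] i]; rewrite /flip; case: ifP => _ [].
    by move=> _ /inv_neq.
  by move/neg_neq.
have swap_free e : swap e <> e.
  case: e => [[x s] i]; rewrite /swap; case: ifP => xs; last by case=> /neg_neq.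
  case xst: (other x s) => [t|]; last by case=> /neg_neq.
  by have [_ _ /eqP ne] := other_sym xs xst; case.
have [D DP] := alternating_set flipK swapK flip_free swap_free.
pose W s : set X := [set x |
  (L < nu x /\ nu (step s x) <= nu x) \/ (inner x s /\ D (x, s, false))].
exists W; split=> [x s t|x s].
  case: (eqVneq s t) => // st.
  case=> [[x_high xs]|[xs Ds]] [[x_high' xt]|[xt Dt]].
  - by case: (high x_high st xs xt).
  - by case/andP: xt; rewrite leNgt x_high.
  - by case/andP: xs; rewrite leNgt x_high'.
  exfalso; have [_ []] := DP (x, s, false); rewrite /swap xs.
  case xst: (other x s) => [u|].
    have [xu ixu us] := other_sym xs xst.
    suff <-: t = u by move=> /(_ Dt).
    apply/eqP/negPn/negP => tu.
    case/andP: xs => x_low xs; case/andP: xt => _ xt; case/andP: ixu => _ xu'.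
    apply: (low x_low _ xs xt xu').
    by rewrite /= !inE negb_or st tu eq_sym us.
  move: xst; rewrite /other; case: pickP => // /(_ t).
  by rewrite eq_sym st xt.
have [ixs|] := boolP (inner x s).
  have [|nD] := pselect (D (x, s, false)); first by left; right.
  right; right; rewrite inner_inv; split=> //.
  by have [[_]] := DP (x, s, false); rewrite /flip ixs => /(_ nD).
rewrite negb_and -!ltNge.
case: (leP (nu (step s x)) (nu x)) => [le_sx|lt_xs] out.
  left; left; split=> //; case/orP: out => // /lt_le_trans; exact.
right; left; rewrite stepK; split; last exact: ltW.
by case/orP: out => // /lt_trans; apply.
Qed.

End Orientation.

Definition letter_elt (G : groupType) (a b : G) (s : letter) : G :=
  let c := if s.1 then a else b in if s.2 then c else c^-1%g.

Section HeightParadox.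
Variables (R : realDomainType) (G : groupType) (X : Type).
Variables (act : group_action G X) (a b : G) (nu : X -> R) (L : R).
Let step s := act (letter_elt a b s).
Hypothesis high : forall x s t, L < nu x -> s != t ->
  nu (step s x) <= nu x -> nu (step t x) <= nu x -> False.
Hypothesis low : forall x s t u, nu x <= L -> uniq [:: s; t; u] ->
  nu (step s x) <= L -> nu (step t x) <= L -> nu (step u x) <= L -> False.

Lemma height_paradoxical : paradoxical act [set 1%g; a; b] 4 [set: X].
Proof.
have stepK s : cancel (step s) (step (inv_letter s)).
  move=> x; rewrite /step -act_funM.
  suff ->: (letter_elt a b (inv_letter s) * letter_elt a b s)%g = 1%g.
    exact: act_fun1.
  by case: s => -[] [] /=; rewrite ?mulVg ?mulgV.
have [W [W_uniq W_cover]] := orientation stepK high low.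
(* The edge joining y to c^-1 y, for c = a or b, points either to y, which then
   stays in place, or to c^-1 y, which is moved to y by c. *)
pose shift (s : letter) : G := if s.2 then (if s.1 then a else b) else 1%g.
pose I i := [set s : letter | s.1 == i]%SET.
have cover i : [set: X] = \bigcup_(s in [set` I i]) (act (shift s) @` W s).
  apply/seteqP; split=> // y _; case: (W_cover y (i, false)) => wy.
    exists (i, false); first by rewrite /= inE.
    by exists y => //; rewrite /= act_fun1.
  exists (i, true); first by rewrite /= inE.
  exists (step (i, false) y) => //.
  have := stepK (i, false) y; rewrite /step /inv_letter /= => {2}<-.
  by rewrite /shift /letter_elt /=.
have card_I i : #|I i| = 2%N.
  have -> : I i = [set (i, true); (i, false)]%SET.
    by apply/setP => -[x y]; rewrite !inE /= !xpair_eqE; case: i x y => -[] [].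
  by rewrite cards2 xpair_eqE eqxx.
exists 2%N, 2%N; split=> //.
exists letter, (I true), (I false), shift, W; split; split=> //.
- by apply/setP=> -[x y]; rewrite !inE /=; case: x.
- by apply/setP=> -[x y]; rewrite !inE /=; case: x.
- by case=> -[] []; [left; right|left; left|right|left; left].
- by move=> s t _ _ [x [ws wt]]; apply: W_uniq ws wt.
Qed.

End HeightParadox.

(** * Hyperbolic maps in general position *)

(** The point [x] has coordinates [x1 x], [x2 x] and, for each letter [s], is
    [c s x] times the expanding direction [e s] plus
    [c (inv_letter s) x] times the contracting direction, based at the fixed
    point [p s.1]; the letter multiplies these by [A] and [A^-1].  The two
    directions of one map may be arbitrarily close to each other, so the
    coordinates may be much larger than the height. *)
Section PingPong.
Variables (R : realFieldType) (X : Type) (step : letter -> X -> X).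
Variables (x1 x2 : X -> R) (p1 p2 : bool -> R).
Variables (c : letter -> X -> R) (e1 e2 : letter -> R) (K A : R).
Hypothesis K_ge : 600 <= K.
Hypothesis A_ge : K ^+ 7 <= A.
Hypothesis x1E : forall s x, x1 x =
  p1 s.1 + c s x * e1 s + c (inv_letter s) x * e1 (inv_letter s).
Hypothesis x2E : forall s x, x2 x =
  p2 s.1 + c s x * e2 s + c (inv_letter s) x * e2 (inv_letter s).
Hypothesis c_step : forall s x, c s (step s x) = A * c s x.
Hypothesis c_inv_step : forall s x,
  c (inv_letter s) (step s x) = A^-1 * c (inv_letter s) x.
Hypothesis p1_le : forall i, `|p1 i| <= K.
Hypothesis p2_le : forall i, `|p2 i| <= K.
Hypothesis e1_le : forall s, `|e1 s| <= K.
Hypothesis e2_le : forall s, `|e2 s| <= K.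
Hypothesis e_ge : forall s, 1 <= `|e1 s| \/ 1 <= `|e2 s|.
Hypothesis e_transverse : forall s t, s.1 != t.1 ->
  1 <= `|e1 s * e2 t - e2 s * e1 t|.
Hypothesis p_transverse : forall s,
  1 <= K * `|(p1 true - p1 false) * e2 s - (p2 true - p2 false) * e1 s|.

Definition height x := Num.max `|x1 x| `|x2 x|.
Definition height_bound : R := 11 * K ^+ 3.

Let normM_le (x y a b : R) : `|x| <= a -> `|y| <= b -> `|x * y| <= a * b.
Proof. by move=> *; rewrite normrM ler_pM. Qed.

Let K_gt0 : 0 < K. Proof. by move: K_ge; lra. Qed.
Let K2_ge : 600 * K <= K ^+ 2. Proof. by rewrite expr2 ler_pM2r. Qed.
Let K3_ge : 600 * K ^+ 2 <= K ^+ 3.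
Proof. by rewrite [leRHS]exprS ler_wpM2r // exprn_ge0 // ltW. Qed.
Let A_gt0 : 0 < A. Proof. by apply: lt_le_trans A_ge; rewrite exprn_gt0. Qed.
Let K4_ge : 600 <= K ^+ 4.
Proof.
have : 1 * 600 <= K ^+ 3 * K.
  by rewrite ler_pM // exprn_ege1 //; move: K_ge; lra.
by rewrite mul1r -exprSr.
Qed.
Let A_ge600 : 600 <= A.
Proof.
apply: le_trans A_ge; rewrite (exprD K 3 4).
have : 1 * 600 <= K ^+ 3 * K ^+ 4.
  by rewrite ler_pM // exprn_ege1 //; move: K_ge; lra.
by rewrite mul1r.
Qed.
Let AV_le : A^-1 <= 600^-1.
Proof. by rewrite lef_pV2 // posrE; move: A_gt0; lra. Qed.
Let AV_gt0 : 0 < A^-1. Proof. by rewrite invr_gt0. Qed.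

(** If the letter [s] does not raise the height above [m], the component of [x]
    that it expands is of order [m / A].  Only this component is estimated; the
    other one, whose size is not controlled by the height, is eliminated by
    writing the difference of [step s x] and [A^-1 x]. *)
Let contract s x m : K <= m -> height x <= m -> height (step s x) <= m ->
  `|c s x| <= 8 * m / A.
Proof.
move=> Km; rewrite !ge_max => /andP[hx1 hx2] /andP[hy1 hy2].
have main (z w p e e' : R) : 1 <= `|e| -> `|p| <= K -> `|z| <= m -> `|w| <= m ->
    z = p + c s x * e + c (inv_letter s) x * e' ->
    w = p + A * c s x * e + A^-1 * c (inv_letter s) x * e' ->
    `|c s x| <= 8 * m / A.
  move=> e_ge1 p_le z_le w_le zE wE.
  have key : (A - A^-1) * (c s x * e) = w - p - A^-1 * (z - p).
    by rewrite zE wE; ring.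
  have zp : `|A^-1 * (z - p)| <= 600^-1 * (m + K).
    apply: normM_le; first by rewrite ger0_norm // ltW.
    by apply: le_trans (ler_normB _ _) _; lra.
  have bnd : `|(A - A^-1) * (c s x * e)| <= 4 * m.
    rewrite key; apply: le_trans (ler_normB _ _) _.
    by have := ler_normB w p; have := normr_ge0 z; lra.
  rewrite !normrM in bnd.
  have c0 := normr_ge0 (c s x).
  have A1 : A / 2 <= `|A - A^-1|.
    by rewrite ger0_norm; move: A_ge600 AV_le; lra.
  have ce : `|c s x| <= `|c s x| * `|e| by rewrite ler_peMr.
  have : A / 2 * `|c s x| <= `|A - A^-1| * (`|c s x| * `|e|).
    by rewrite ler_pM //; move: A_gt0; lra.
  by rewrite ler_pdivlMr //; lra.
case: (e_ge s) => es.
  apply: main es (p1_le s.1) hx1 hy1 (x1E s x) _.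
  by rewrite (x1E s) c_step c_inv_step.
apply: main es (p2_le s.1) hx2 hy2 (x2E s x) _.
by rewrite (x2E s) c_step c_inv_step.
Qed.

Let scale_le m : 0 <= m -> K ^+ 3 * (8 * m / A) <= 8 * m / K ^+ 4.
Proof.
move=> m0; have K40 : 0 < K ^+ 4 by rewrite exprn_gt0.
rewrite ler_pdivlMr // mulrAC -exprD mulrA ler_pdivrMr // mulrC.
by rewrite ler_wpM2l // mulr_ge0.
Qed.

Let scale_le600 m : 0 <= m -> K ^+ 3 * (8 * m / A) <= 8 * m / 600.
Proof.
move=> m0; apply: le_trans (scale_le m0) _; rewrite ler_wpM2l ?mulr_ge0 //.
by rewrite lef_pV2 // posrE //; move: K4_ge; lra.
Qed.

Let det_le (a b a' b' r q : R) :
  `|a| <= r -> `|b| <= r -> `|a'| <= q -> `|b'| <= q ->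
  `|a * b' - b * a'| <= 2 * (r * q).
Proof.
move=> ha hb ha' hb'; apply: le_trans (ler_normB _ _) _.
have := normM_le ha hb'; have := normM_le hb ha'; lra.
Qed.

Let inv_neq (s t : letter) : s != t -> s.1 = t.1 -> t = inv_letter s.
Proof. by case: s t => -[] [] [[] []]. Qed.

(** Two small coordinates of one map put [x] near its fixed point; one small
    coordinate of each map puts [x] near the intersection of two transverse
    eigenlines.  Either way the height of [x] is at most of order [K ^+ 3]. *)
Lemma high_expands x s t : height_bound < height x -> s != t ->
  height (step s x) <= height x -> height (step t x) <= height x -> False.
Proof.
move=> hx st hs ht.
have Kh : K <= height x.
  apply: le_trans (ltW hx); rewrite /height_bound.
  by move: K_ge K2_ge K3_ge; lra.
have cs := contract Kh (lexx _) hs; have ct := contract Kh (lexx _) ht.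
have h0 : 0 <= height x by move: K_gt0; lra.
have d0 : 0 <= 8 * height x / A by rewrite divr_ge0 ?mulr_ge0 // ltW.
have dle := scale_le600 h0.
set d := 8 * height x / A in cs ct d0 dle *.
have Kd (n : nat) : (n <= 3)%N -> K ^+ n * d <= K ^+ 3 * d.
  by move=> n3; rewrite ler_wpM2r // ler_weXn2l //; move: K_ge; lra.
have d1 := Kd 0%N isT; have d2 := Kd 1%N isT; have d3 := Kd 2%N isT.
rewrite expr0 mul1r in d1; rewrite expr1 in d2.
have coord_le (z p u v e e' r : R) : z = p + u * e + v * e' -> `|p| <= K ->
    `|e| <= K -> `|e'| <= K -> `|u| <= d -> `|v| <= r ->
    `|z| <= K + d * K + r * K.
  move=> -> hp he he' hu hv.
  have := normM_le hu he; have := normM_le hv he'.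
  have := ler_normD (p + u * e) (v * e'); have := ler_normD p (u * e); lra.
case: (eqVneq s.1 t.1) => st1.
  have tE := inv_neq st st1; rewrite tE in ct.
  have h1 := coord_le _ _ _ _ _ _ _ (x1E s x) (p1_le _)
    (e1_le _) (e1_le _) cs ct.
  have h2 := coord_le _ _ _ _ _ _ _ (x2E s x) (p2_le _)
    (e2_le _) (e2_le _) cs ct.
  have : height x <= K + d * K + d * K by rewrite ge_max h1.
  by move: hx K_ge K2_ge K3_ge; rewrite /height_bound; lra.
set s' := inv_letter s; set t' := inv_letter t.
(* Cramer's rule for the component along e s', the remaining unknown component
   along e t' being killed by the determinant with e t'. *)
have key : c s' x * (e1 s' * e2 t' - e2 s' * e1 t') =
    ((p1 t.1 - p1 s.1) * e2 t' - (p2 t.1 - p2 s.1) * e1 t')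
    + c t x * (e1 t * e2 t' - e2 t * e1 t')
    - c s x * (e1 s * e2 t' - e2 s * e1 t').
  have E1 := x1E s x; have E2 := x2E s x.
  rewrite (x1E t) -/s' -/t' in E1; rewrite (x2E t) -/s' -/t' in E2.
  have F1 : c s' x * e1 s' =
      p1 t.1 + c t x * e1 t + c t' x * e1 t' - p1 s.1 - c s x * e1 s.
    by rewrite E1; ring.
  have F2 : c s' x * e2 s' =
      p2 t.1 + c t x * e2 t + c t' x * e2 t' - p2 s.1 - c s x * e2 s.
    by rewrite E2; ring.
  by rewrite mulrBr !mulrA F1 F2; ring.
have p_le : `|(p1 t.1 - p1 s.1) * e2 t' - (p2 t.1 - p2 s.1) * e1 t'|
    <= 2 * (2 * K * K).
  apply: det_le => //; apply: le_trans (ler_normB _ _) _.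
    by have := p1_le t.1; have := p1_le s.1; lra.
  by have := p2_le t.1; have := p2_le s.1; lra.
have tt' := normM_le ct (det_le (e1_le t) (e2_le t) (e1_le t') (e2_le t')).
have ss' := normM_le cs (det_le (e1_le s) (e2_le s) (e1_le t') (e2_le t')).
have cs' : `|c s' x| <= 4 * K ^+ 2 + 4 * (K ^+ 2 * d).
  have tr : 1 <= `|e1 s' * e2 t' - e2 s' * e1 t'| by apply: e_transverse.
  apply: le_trans (_ : `|c s' x * (e1 s' * e2 t' - e2 s' * e1 t')| <= _).
    by rewrite normrM ler_peMr.
  rewrite key; apply: le_trans (ler_normB _ _) _.
  apply: le_trans (lerD (le_trans (ler_normD _ _) (lerD p_le tt')) ss') _.
  by rewrite !expr2; lra.
have h1 := coord_le _ _ _ _ _ _ _ (x1E s x) (p1_le _)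
    (e1_le _) (e1_le _) cs cs'.
have h2 := coord_le _ _ _ _ _ _ _ (x2E s x) (p2_le _)
    (e2_le _) (e2_le _) cs cs'.
have : height x <= K + d * K + (4 * K ^+ 2 + 4 * (K ^+ 2 * d)) * K.
  by rewrite ge_max h1.
have -> : (4 * K ^+ 2 + 4 * (K ^+ 2 * d)) * K = 4 * K ^+ 3 + 4 * (K ^+ 3 * d).
  by ring.
by move: hx K_ge K2_ge K3_ge; rewrite /height_bound; lra.
Qed.

Let three_letters (P : letter -> Prop) s t u : uniq [:: s; t; u] ->
  P s -> P t -> P u -> exists s t, [/\ P s, P (inv_letter s), P t & s.1 != t.1].
Proof.
move=> uq ps pt pu.
have pick r r' r'' : r' = inv_letter r -> r.1 != r''.1 ->
    P r -> P r' -> P r'' ->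
    exists s t, [/\ P s, P (inv_letter s), P t & s.1 != t.1].
  by move=> -> ? ? ? ?; exists r, r''.
case: (eqVneq s.1 t.1) => st.
  apply: (pick s t u) => //; first apply: inv_neq => //.
    by move: uq; rewrite /= !inE negb_or => /andP[/andP[]].
  move: uq st {ps pt pu}; case: s t u => -[] [] [[] []] [[] []] //.
case: (eqVneq s.1 u.1) => su.
  apply: (pick s u t) => //; apply: inv_neq => //.
  by move: uq; rewrite /= !inE negb_or => /andP[/andP[]].
apply: (pick t u s) => //; last by rewrite eq_sym.
  by move: uq st su {ps pt pu}; case: s t u => -[] [] [[] []] [[] []].
Qed.

(** Among three letters two are mutually inverse, so [x] is near one fixed point
    while a third small coordinate puts it near an eigenline through the other
    one, against the transversality of that line to the line joining the fixed
    points. *)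
Lemma low_expands x s t u : height x <= height_bound -> uniq [:: s; t; u] ->
  height (step s x) <= height_bound -> height (step t x) <= height_bound ->
  height (step u x) <= height_bound -> False.
Proof.
move=> hx uq hs ht hu.
have [] := three_letters (P := fun s => height (step s x) <= height_bound)
  uq hs ht hu.
move=> {s t u uq hs ht hu} s [t [hs hs' ht st]].
have KL : K <= height_bound.
  by rewrite /height_bound; move: K_ge K2_ge K3_ge; lra.
have cs := contract KL hx hs; have ct := contract KL hx ht.
have cs' := contract KL hx hs'.
have L0 : 0 <= height_bound by move: K_gt0; lra.
have d0 : 0 <= 8 * height_bound / A by rewrite divr_ge0 ?mulr_ge0 // ltW.
have dle := scale_le L0.
set d := 8 * height_bound / A in cs ct cs' d0 dle *.
have {}dle : K * (K ^+ 2 * d) <= 88 / K.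
  rewrite mulrA -exprS; apply: le_trans dle _; rewrite /height_bound.
  by rewrite le_eqVlt; apply/orP; left; apply/eqP; field; move: K_gt0; lra.
set t' := inv_letter t; set s' := inv_letter s in cs' *.
have key : (p1 t.1 - p1 s.1) * e2 t' - (p2 t.1 - p2 s.1) * e1 t' =
    ((c s x * e1 s + c s' x * e1 s') * e2 t'
     - (c s x * e2 s + c s' x * e2 s') * e1 t')
    - c t x * (e1 t * e2 t' - e2 t * e1 t').
  have E1 := x1E s x; have E2 := x2E s x.
  rewrite (x1E t) -/s' -/t' in E1; rewrite (x2E t) -/s' -/t' in E2.
  have F1 : p1 t.1 - p1 s.1 = c s x * e1 s + c s' x * e1 s'
      - c t x * e1 t - c t' x * e1 t'.
    by move: E1; lra.
  have F2 : p2 t.1 - p2 s.1 = c s x * e2 s + c s' x * e2 s'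
      - c t x * e2 t - c t' x * e2 t'.
    by move: E2; lra.
  by rewrite F1 F2; ring.
have near (e e' : R) : `|e| <= K -> `|e'| <= K ->
    `|c s x * e + c s' x * e'| <= d * K + d * K.
  move=> he he'; apply: le_trans (ler_normD _ _) _.
  by rewrite lerD ?normM_le.
have b1 := det_le (near _ _ (e1_le s) (e1_le s'))
  (near _ _ (e2_le s) (e2_le s')) (e1_le t') (e2_le t').
have b2 := normM_le ct (det_le (e1_le t) (e2_le t) (e1_le t') (e2_le t')).
have pt : 1 <= K * `|(p1 t.1 - p1 s.1) * e2 t' - (p2 t.1 - p2 s.1) * e1 t'|.
  have := p_transverse t'; move: st; case: s.1; case: t.1 => // _ h.
  apply: le_trans h _; rewrite le_eqVlt; apply/orP; left; apply/eqP.
  by rewrite -normrN; congr (_ * `|_|); ring.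
have : 1 <= K * (6 * (K ^+ 2 * d)).
  apply: le_trans pt _; rewrite ler_pM2l // key.
  apply: le_trans (ler_normB _ _) _; rewrite expr2; lra.
have : 88 / K <= 88 / 600.
  by rewrite ler_wpM2l // lef_pV2 // ?posrE //; move: K_ge; lra.
lra.
Qed.

End PingPong.

(** * Integer matrices of size two *)

Section TwoByTwo.
Variable R : comNzRingType.
Implicit Types A B : 'M[R]_2.

Lemma sum_ord2 (V : nmodType) (F : 'I_2 -> V) : \sum_(i < 2) F i = F 0 + F 1.
Proof.
by rewrite big_ord_recl big_ord1; congr (_ + F _); apply: val_inj.
Qed.

Lemma det2 A : \det A = A 0 0 * A 1 1 - A 0 1 * A 1 0.
Proof.
rewrite (expand_det_row _ 0) sum_ord2 /cofactor !det_mx11 !mxE /=.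
rewrite expr0 expr1 !mul1r mulN1r mulrN.
by congr (_ * A _ _ - _ * A _ _); apply: val_inj.
Qed.

Lemma tr2 A : \tr A = A 0 0 + A 1 1.
Proof. exact: sum_ord2. Qed.

Lemma mulmx2 m A (B : 'M[R]_(2, m)) i j :
  (A *m B) i j = A i 0 * B 0 j + A i 1 * B 1 j.
Proof. by rewrite mxE sum_ord2. Qed.

Lemma ord2_case (P : 'I_2 -> Prop) : P 0 -> P 1 -> forall i, P i.
Proof.
move=> p0 p1 i; have [->|->] // : i = 0 \/ i = 1.
by case: i => -[|[|//]] ?; [left|right]; apply: val_inj.
Qed.

Lemma matrix2P A B : A 0 0 = B 0 0 -> A 0 1 = B 0 1 ->
  A 1 0 = B 1 0 -> A 1 1 = B 1 1 -> A = B.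
Proof.
by move=> *; apply/matrixP; apply: ord2_case; apply: ord2_case.
Qed.

End TwoByTwo.

Lemma invmx2 (R : comUnitRingType) (A : 'M[R]_2) : \det A = 1 ->
  [/\ invmx A 0 0 = A 1 1, invmx A 0 1 = - A 0 1,
      invmx A 1 0 = - A 1 0 & invmx A 1 1 = A 0 0].
Proof.
move=> A1; have Au : A \in unitmx by rewrite unitmxE A1 unitr1.
pose B : 'M[R]_2 := \matrix_(i, j)
  (if i == 0 then if j == 0 then A 1 1 else - A 0 1
   else if j == 0 then - A 1 0 else A 0 0).
have AB : A *m B = 1%:M.
  rewrite det2 in A1.
  by apply: matrix2P; rewrite mulmx2 !mxE /= ?mulr1n ?mulr0n -?A1; ring.
suff -> : invmx A = B by rewrite !mxE.
by rewrite -[LHS]mulmx1 -AB mulmxA mulVmx // mul1mx.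
Qed.

(** The only square of the form t^2 - 4 is 0.  With t the trace of an integer
    matrix of determinant 1, this says that its eigenvalues are irrational
    unless t^2 = 4. *)
Lemma discriminant_not_square (t w y : int) :
  y != 0 -> w ^+ 2 = (t ^+ 2 - 4) * y ^+ 2 -> w = 0 /\ t ^+ 2 = 4.
Proof.
move=> y0 e.
have /dvdzP[z wE] : (y %| w)%Z.
  by rewrite -(@dvdz_pexp2r y w 2) // e dvdz_mull.
move: e; rewrite {}wE exprMn => /(mulIf (expf_neq0 2 y0)) e.
suff z0 : z = 0 by split; [rewrite z0 mul0r | move: e; rewrite z0; lia].
have [m mE] : exists m : nat, z ^+ 2 = (m * m)%:Z.
  by exists `|z|%N; rewrite PoszM -expr2 abszE real_normK ?num_real.
have [n nE] : exists n : nat, t ^+ 2 = (n * n)%:Z.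
  by exists `|t|%N; rewrite PoszM -expr2 abszE real_normK ?num_real.
have mn : (m * m + 4 = n * n)%N by lia.
suff m0 : m = 0%N by apply/eqP; rewrite -sqrf_eq0 mE m0.
have lt_mn : (m < n)%N by nia.
have n_le : (n <= 2)%N by nia.
case: n mn lt_mn n_le {nE} => [|[|[|]]] //;
  by case: m {mE} => [|[|[|]]] //; lia.
Qed.

(** The quadratic form is det(v, g v) for v = (x, y) and g with rows (p, q) and
    (r, s); completing the square gives its discriminant (p + s)^2 - 4. *)
Lemma no_integer_eigenvector (p q r s x y : int) :
  p * s - q * r = 1 -> 4 < (p + s) ^+ 2 ->
  r * x ^+ 2 + (s - p) * x * y - q * y ^+ 2 = 0 -> x = 0 /\ y = 0.
Proof.
move=> d1 tr4 e.
have key : (2 * r * x + (s - p) * y) ^+ 2 = ((p + s) ^+ 2 - 4) * y ^+ 2.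
  have -> : (2 * r * x + (s - p) * y) ^+ 2 = ((p + s) ^+ 2 - 4) * y ^+ 2
     + 4 * r * (r * x ^+ 2 + (s - p) * x * y - q * y ^+ 2)
     + 4 * (1 - (p * s - q * r)) * y ^+ 2 by ring.
  by rewrite e d1; ring.
have y0 : y = 0.
  apply/eqP/negPn/negP => /discriminant_not_square/(_ key)[_] h.
  by rewrite h in tr4.
split=> //; rewrite y0 !expr2 !(mulr0, addr0, subr0) in key.
apply/eqP/negPn/negP => x0.
have r0 : r = 0.
  move/eqP: key; rewrite sqrf_eq0 !mulf_eq0 (negPf x0) orbF /=.
  by move/eqP.
have [] // := @discriminant_not_square (p + s) (p - s) 1.
  have ps1 : p * s = 1 by rewrite -d1 r0 mulr0 subr0.
  have -> : (p - s) ^+ 2 = (p + s) ^+ 2 - 4 * (p * s) by ring.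
  by rewrite ps1; ring.
by move=> _ h; rewrite h in tr4.
Qed.

(** The expression assumed nonpositive is - det (g k - k g), where g has rows
    (p, q) and (r, s) and k has rows (a, b) and (c, d).  If g is elliptic, this
    is a definite form in the commutator.  If g is parabolic, vanishing of the
    determinant means that k preserves the fixed line of g; the eigenvalues of k
    are then rational, hence equal to 1 or to -1, and k commutes with g. *)
Lemma commutator_discriminant (p q r s a b c d : int) :
  p * s - q * r = 1 -> a * d - b * c = 1 -> (p + s) ^+ 2 <= 4 ->
  (q * c - r * b) ^+ 2 +
    (b * (p - s) - q * (a - d)) * (r * (a - d) - c * (p - s)) <= 0 ->
  [/\ q * c - r * b = 0, b * (p - s) - q * (a - d) = 0
    & r * (a - d) - c * (p - s) = 0].
Proof.
move=> g1 k1 trg.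
set X := p - s; set x := a - d; set T := p + s in trg *; set t := a + d.
have discg : X ^+ 2 + 4 * q * r = T ^+ 2 - 4.
  have -> : X ^+ 2 + 4 * q * r = T ^+ 2 - 4 * (p * s - q * r).
    by rewrite /X /T; ring.
  by rewrite g1.
have disck : x ^+ 2 + 4 * b * c = t ^+ 2 - 4.
  have -> : x ^+ 2 + 4 * b * c = t ^+ 2 - 4 * (a * d - b * c).
    by rewrite /x /t; ring.
  by rewrite k1.
clearbody X x T t; move=> {p s a d g1 k1}.
set c1 := q * c - r * b; set c2 := b * X - q * x; set c3 := r * x - c * X.
move=> S_le0.
(* The commutator is orthogonal to the traceless part of g. *)
have orth : X * c1 + q * c3 + r * c2 = 0 by rewrite /c1 /c2 /c3; ring.
have key : (2 * q * c1 - X * c2) ^+ 2 + (4 - T ^+ 2) * c2 ^+ 2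
    = 4 * q ^+ 2 * (c1 ^+ 2 + c2 * c3).
  have -> : 4 - T ^+ 2 = - (X ^+ 2 + 4 * q * r) by rewrite discg; ring.
  have -> : 4 * q ^+ 2 * (c1 ^+ 2 + c2 * c3)
    = 4 * q ^+ 2 * c1 ^+ 2 + 4 * q * c2 * (q * c3) by ring.
  have -> : q * c3 = - (X * c1 + r * c2) by rewrite -[RHS]addr0 -orth; ring.
  by ring.
(* Gram determinant of the traceless parts of g and k for the trace form. *)
have gram : (X * x + 2 * q * c + 2 * r * b) ^+ 2
    = 4 * (c1 ^+ 2 + c2 * c3) + (T ^+ 2 - 4) * (t ^+ 2 - 4).
  by rewrite -discg -disck /c1 /c2 /c3; ring.
have sq0 (z : int) : z ^+ 2 <= 0 -> z = 0.
  by move=> z0; apply/eqP; rewrite -sqrf_eq0 eq_le z0 sqr_ge0.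
case: (eqVneq (T ^+ 2) 4) => T4.
  have polar : X * x + 2 * q * c + 2 * r * b = 0.
    by apply: sq0; rewrite gram T4 subrr mul0r addr0 pmulr_rle0.
  rewrite T4 subrr in discg.
  have sq2 : c2 ^+ 2 = (t ^+ 2 - 4) * q ^+ 2.
    rewrite -disck.
    have -> : c2 ^+ 2 = (x ^+ 2 + 4 * b * c) * q ^+ 2
      + b ^+ 2 * (X ^+ 2 + 4 * q * r)
      - 2 * b * q * (X * x + 2 * q * c + 2 * r * b) by rewrite /c2; ring.
    by rewrite discg polar; ring.
  have sq3 : c3 ^+ 2 = (t ^+ 2 - 4) * r ^+ 2.
    rewrite -disck.
    have -> : c3 ^+ 2 = (x ^+ 2 + 4 * b * c) * r ^+ 2
      + c ^+ 2 * (X ^+ 2 + 4 * q * r)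
      - 2 * c * r * (X * x + 2 * q * c + 2 * r * b) by rewrite /c3; ring.
    by rewrite discg polar; ring.
  have c20 : c2 = 0.
    have [q0|q0] := eqVneq q 0; last first.
      by have [] := discriminant_not_square q0 sq2.
    by apply: sq0; rewrite sq2 q0 expr0n mulr0.
  have c30 : c3 = 0.
    have [r0|r0] := eqVneq r 0; last first.
      by have [] := discriminant_not_square r0 sq3.
    by apply: sq0; rewrite sq3 r0 expr0n mulr0.
  by split=> //; apply: sq0; move: S_le0; rewrite c20 mul0r addr0.
have T_lt : T ^+ 2 < 4 by lia.
have q0 : q != 0.
  apply/eqP => q0; move: discg; rewrite q0 mulr0 mul0r addr0 => discg.
  by move: (sqr_ge0 X); rewrite discg; move: T_lt; lra.
have rhs0 : 4 * q ^+ 2 * (c1 ^+ 2 + c2 * c3) <= 0.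
  by rewrite mulr_ge0_le0 // mulr_ge0 // sqr_ge0.
have A0 := sqr_ge0 (2 * q * c1 - X * c2); have B0 := sqr_ge0 c2.
have c2_le : c2 ^+ 2 <= (4 - T ^+ 2) * c2 ^+ 2.
  by rewrite ler_peMl // lerBrDr lez1D.
have c20 : c2 = 0 by apply: sq0; move: key A0 c2_le rhs0; lra.
have c10 : c1 = 0.
  have : 2 * q * c1 - X * c2 = 0.
    by apply: sq0; move: key rhs0; rewrite c20; lra.
  rewrite c20 mulr0 subr0 => /eqP; rewrite !mulf_eq0 (negPf q0) /= => /eqP.
  by [].
split=> //; move: orth; rewrite c10 c20 !mulr0 addr0 add0r => /eqP.
by rewrite mulf_eq0 (negPf q0) => /eqP.
Qed.

(** The image of [C] is invariant under [g], so if [C] had rank one a column of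
    [C] would be an integer eigenvector of [g]. *)
Lemma intertwiner_singular_eq0 (g C M : 'M[int]_2) :
  \det g = 1 -> 4 < (\tr g) ^+ 2 -> g *m C = C *m M -> \det C = 0 -> C = 0.
Proof.
rewrite !det2 tr2 => g1 trg gC C0.
have col (j : 'I_2) : C 0 j = 0 /\ C 1 j = 0.
  apply: no_integer_eigenvector g1 trg _.
  have e0 : (g *m C) 0 j = (C *m M) 0 j by rewrite gC.
  have e1 : (g *m C) 1 j = (C *m M) 1 j by rewrite gC.
  rewrite !mulmx2 in e0 e1.
  have -> : g 1 0 * C 0 j ^+ 2 + (g 1 1 - g 0 0) * C 0 j * C 1 j
      - g 0 1 * C 1 j ^+ 2 = C 0 j * (g 1 0 * C 0 j + g 1 1 * C 1 j)
      - C 1 j * (g 0 0 * C 0 j + g 0 1 * C 1 j) by ring.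
  rewrite e0 e1; elim/ord2_case: j {e0 e1}.
    by rewrite -[RHS](mulr0 (M 1 0)) -C0; ring.
  by rewrite -[RHS](mulr0 (- M 0 1)) -C0; ring.
by apply: matrix2P; rewrite !mxE; case: (col 0); case: (col 1).
Qed.

(** A matrix commuting with the nonscalar [g] is an affine function of [g]. *)
Lemma centralizer_commutative (g x y : 'M[int]_2) :
  \det g = 1 -> 4 < (\tr g) ^+ 2 ->
  g *m x = x *m g -> g *m y = y *m g -> x *m y = y *m x.
Proof.
rewrite det2 tr2 => g1 trg gx gy.
have q0 : g 0 1 != 0.
  apply/eqP => q0.
  have [] // := no_integer_eigenvector (x := 0) (y := 1) g1 trg.
  by rewrite q0; ring.
have entry u : g *m u = u *m g -> g 0 1 * u 1 0 = g 1 0 * u 0 1 /\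
    g 0 1 * (u 0 0 - u 1 1) = (g 0 0 - g 1 1) * u 0 1.
  move=> e.
  have e0 : (g *m u) 0 0 = (u *m g) 0 0 by rewrite e.
  have e1 : (g *m u) 0 1 = (u *m g) 0 1 by rewrite e.
  rewrite !mulmx2 in e0 e1.
  split; first by apply: (addrI (g 0 0 * u 0 0)); rewrite e0; ring.
  have -> : g 0 1 * (u 0 0 - u 1 1) = (u 0 0 * g 0 1 + u 0 1 * g 1 1)
     - (u 0 1 * g 1 1 + g 0 1 * u 1 1) by ring.
  by rewrite -e1; ring.
have [x1 x2] := entry x gx; have [y1 y2] := entry y gy.
have c1 : x 0 1 * y 1 0 = x 1 0 * y 0 1.
  apply: (mulfI q0); rewrite mulrCA y1 [RHS]mulrA x1; ring.
have c2 : x 0 1 * (y 0 0 - y 1 1) = (x 0 0 - x 1 1) * y 0 1.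
  apply: (mulfI q0); rewrite mulrCA y2 [RHS]mulrA x2; ring.
have c3 : x 1 0 * (y 0 0 - y 1 1) = (x 0 0 - x 1 1) * y 1 0.
  apply: (mulfI q0); rewrite mulrA x1 [RHS]mulrCA y1 -mulrA c2; ring.
by apply: matrix2P; rewrite !mulmx2; lra.
Qed.

Lemma thetaM g h : theta (g * h)%g = theta g *m theta h. Proof. by []. Qed.
Lemma tauM g h : tau (g * h)%g = theta g *m tau h + tau g. Proof. by []. Qed.
Lemma thetaV g : theta g^-1%g = invmx (theta g). Proof. by []. Qed.
Lemma theta1 : theta 1%g = 1%:M. Proof. by []. Qed.

Lemma tr_commutator (g k : SA2Z) :
  \tr (theta (g * k * g^-1 * k^-1)%g) =
  2 - \det (theta g *m theta k - theta k *m theta g).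
Proof.
have [i00 i01 i10 i11] := invmx2 (det_theta g).
have [j00 j01 j10 j11] := invmx2 (det_theta k).
have g1 := det_theta g; have k1 := det_theta k; rewrite !det2 in g1 k1.
rewrite !thetaM !thetaV tr2 det2 !mxE !sum_ord2 !mulmx2.
rewrite i00 i01 i10 i11 j00 j01 j10 j11.
(* The identity becomes homogeneous, hence valid for all matrices, once 2 is
   replaced by 2 det g det k. *)
set d := (X in _ = 2 - X).
have -> : 2 - d = 2 * (theta g 0 0 * theta g 1 1 - theta g 0 1 * theta g 1 0)
    * (theta k 0 0 * theta k 1 1 - theta k 0 1 * theta k 1 0) - d.
  by rewrite g1 k1 !mulr1.
by rewrite /d; ring.
Qed.

Lemma commutator_hyperbolic (g k : SA2Z) : (\tr (theta g)) ^+ 2 <= 4 ->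
  theta g *m theta k <> theta k *m theta g ->
  4 < (\tr (theta (g * k * g^-1 * k^-1)%g)) ^+ 2.
Proof.
move=> trg ngk; rewrite tr_commutator.
have g1 := det_theta g; have k1 := det_theta k; rewrite !det2 in g1 k1.
rewrite tr2 in trg.
have disc := commutator_discriminant g1 k1 trg.
set C := theta g *m theta k - theta k *m theta g.
have C00 : C 0 0 = theta g 0 1 * theta k 1 0 - theta g 1 0 * theta k 0 1.
  by rewrite !mxE !sum_ord2; ring.
have C11 : C 1 1 = - (theta g 0 1 * theta k 1 0 - theta g 1 0 * theta k 0 1).
  by rewrite !mxE !sum_ord2; ring.
have C01 : C 0 1 = theta k 0 1 * (theta g 0 0 - theta g 1 1)
    - theta g 0 1 * (theta k 0 0 - theta k 1 1).
  by rewrite !mxE !sum_ord2; ring.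
have C10 : C 1 0 = theta g 1 0 * (theta k 0 0 - theta k 1 1)
    - theta k 1 0 * (theta g 0 0 - theta g 1 1).
  by rewrite !mxE !sum_ord2; ring.
have : \det C <= -1.
  rewrite -ltzD1 addNr ltNge; apply/negP => C_ge0; apply: ngk.
  have [] := disc.
    rewrite -oppr_ge0; apply: le_trans C_ge0 _.
    by rewrite det2 C00 C11 C01 C10 le_eqVlt; apply/orP; left; apply/eqP; ring.
  rewrite -C00 -C01 -C10 => z00 z01 z10; apply/eqP; rewrite -subr_eq0 -/C.
  by apply/eqP/matrix2P; rewrite [RHS]mxE ?z00 ?z01 ?z10 // C11 -C00 z00 oppr0.
by move: (\det C) => D D_le; rewrite expr2; nia.
Qed.

(** * Solvable subgroups and words of bounded length *)

Section GroupSets.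
Variable G : groupType.
Implicit Types (S H K : set G).

Lemma subgroup_generated S : is_subgroup (generated_subgroup S).
Proof.
split=> [H [[H1 _] _] //|x y gx gy H HS].
by have [[_ Hm] _] := HS; apply: Hm; [apply: gx|apply: gy].
Qed.

Lemma generated_sub S H :
  is_subgroup H -> S `<=` H -> generated_subgroup S `<=` H.
Proof. by move=> Hg SH x; apply. Qed.

Lemma derived_sub H K L : is_subgroup L -> H `<=` K ->
  (forall x y, K x -> K y -> L [~ x, y]%g) -> derived_subgroup H `<=` L.
Proof.
move=> Lg HK KL; apply: generated_sub => // _ [x Hx [y Hy <-]].
by apply: KL; apply: HK.
Qed.

Lemma solvable_subgroup_chain H N C T :
  is_subgroup H -> is_subgroup C -> is_subgroup T -> H `<=` N ->
  (forall x y, N x -> N y -> C [~ x, y]%g) ->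
  (forall x y, C x -> C y -> T [~ x, y]%g) ->
  (forall x y, T x -> T y -> [~ x, y]%g = 1%g) -> virtually_solvable H.
Proof.
move=> Hg Cg Tg HN NC CT T1; exists H; split=> //.
  rewrite (_ : left_cosets H H = [set H]); first exact: finite_set1.
  have [H1 HB] := Hg.
  have HV x : H x -> H x^-1%g.
    by move=> Hx; rewrite -[x^-1%g]mul1g; apply: HB.
  have HM x y : H x -> H y -> H (x * y)%g.
    by move=> Hx Hy; rewrite -[y]invgK; apply/HB/HV.
  apply/seteqP; split=> [_ [x Hx <-]|_ ->] /=.
    apply/seteqP; split=> [_ [y Hy <-]|y Hy] /=; first exact: HM.
    by exists (x^-1 * y)%g; [apply/HM => //; apply: HV|rewrite mulVKg].
  exists 1%g => //; apply/seteqP; split=> [_ [y Hy <-]|y Hy] /=.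
    by rewrite mul1g.
  by exists y => //; rewrite mul1g.
exists 3%N; rewrite /=.
have g1 : is_subgroup [set 1%g : G].
  by split=> // x y /= -> ->; rewrite invg1 mulg1.
apply/seteqP; split; last by move=> _ ->; have [] := subgroup_generated
  [set [~ x, y]%g | x in derived_subgroup (derived_subgroup H)
                  & y in derived_subgroup (derived_subgroup H)].
apply: (derived_sub (K := T)) => //.
by apply: (derived_sub (K := C)) => //; apply: (derived_sub (K := N)).
Qed.

Variable S : set G.
Hypothesis S1 : S 1%g.
Hypothesis SV : symmetric_gset S.

(** Bounding [x] and its inverse together makes the notion stable under
    inversion without reversing products. *)
Definition short_word n x := gset_pow S n x /\ gset_pow S n x^-1%g.

Let gset_powM m n x y : gset_pow S m x -> gset_pow S n y ->
  gset_pow S (m + n) (x * y)%g.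
Proof.
move=> [s Ss <-] [t St <-].
exists (fun i => match fintype.split i with inl j => s j | inr j => t j end).
  by move=> i; case: fintype.split.
rewrite big_split_ord; congr (_ * _)%g; apply: eq_bigr => i _.
  by rewrite (unsplitK (inl i)).
by rewrite (unsplitK (inr i)).
Qed.

Let gset_pow1 n : gset_pow S n 1%g.
Proof. by exists (fun=> 1%g) => //; rewrite big1. Qed.

Lemma short_word_le m n x : (m <= n)%N -> short_word m x -> short_word n x.
Proof.
move=> mn [sx sVx]; rewrite -(subnKC mn) /short_word.
by split; rewrite -[X in gset_pow _ _ X]mulg1; apply: gset_powM.
Qed.

Lemma short_wordM m n x y : short_word m x -> short_word n y ->
  short_word (m + n) (x * y)%g.
Proof.
move=> [sx sVx] [sy sVy]; split; first exact: gset_powM.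
by rewrite invgM addnC; apply: gset_powM.
Qed.

Lemma short_wordV n x : short_word n x -> short_word n x^-1%g.
Proof. by case=> sx sVx; split; rewrite ?invgK. Qed.

Lemma short_wordX m n x : short_word m x -> short_word (n * m) (x ^+ n)%g.
Proof.
move=> sx; elim: n => [|n IHn].
  by rewrite expg0; split; rewrite ?invg1; apply: gset_pow1.
by rewrite expgS mulSn; apply: short_wordM.
Qed.

Lemma short_word1 x : S x -> short_word 1 x.
Proof.
have pow1 y : S y -> gset_pow S 1 y.
  by move=> Sy; exists (fun=> y) => //; rewrite big_ord1.
by move=> Sx; split; apply: pow1 => //; rewrite -SV; exists x.
Qed.

End GroupSets.

(** * Linear parts *)

Section LinearPart.
Implicit Types g h k x y : SA2Z.

Definition translations : set SA2Z := [set x | theta x = 1%:M].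

Lemma subgroup_translations : is_subgroup translations.
Proof.
split=> // x y; rewrite /translations /= thetaM thetaV => -> ->.
by rewrite invmx1 mulmx1.
Qed.

Lemma commg_eq1 (G : groupType) (x y : G) :
  (x * y)%g = (y * x)%g -> [~ x, y]%g = 1%g.
Proof. by move=> xy; rewrite commgEl conjgE xy mulKg mulVg. Qed.

Lemma translations_commute x y :
  translations x -> translations y -> [~ x, y]%g = 1%g.
Proof.
rewrite /translations /= => x1 y1; apply: commg_eq1; apply: SA2Z_eq.
  by rewrite !thetaM x1 y1.
by rewrite !tauM x1 y1 !mul1mx addrC.
Qed.

Fact linear_part_det g : \det (theta g) == 1. Proof. by rewrite det_theta. Qed.

(** The linear part as an element of the same group, so that conjugation of
    linear parts is computed with the group laws. *)
Definition linear_part g : SA2Z := @MkSA2Z (theta g, 0) (linear_part_det g).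

Lemma theta_linear_part g : theta (linear_part g) = theta g. Proof. by []. Qed.

Lemma linear_partM g h :
  linear_part (g * h)%g = (linear_part g * linear_part h)%g.
Proof. by apply: SA2Z_eq; rewrite // tauM /tau /= mulmx0 addr0. Qed.

Lemma linear_part1 : linear_part 1%g = 1%g. Proof. exact: SA2Z_eq. Qed.

Lemma linear_partV g : linear_part g^-1%g = (linear_part g)^-1%g.
Proof.
by apply: (mulgI (linear_part g)); rewrite -linear_partM !mulgV linear_part1.
Qed.

Lemma linear_part_eq1 g : linear_part g = 1%g -> translations g.
Proof. by move=> g1; rewrite /translations /= -theta_linear_part g1. Qed.

Lemma linear_part_comm g h :
  theta g *m theta h = theta h *m theta g ->
  commute (linear_part g) (linear_part h).
Proof.
by move=> gh; rewrite /commute -!linear_partM; apply: SA2Z_eq.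
Qed.

Lemma comm_translations g h :
  theta g *m theta h = theta h *m theta g -> translations [~ g, h]%g.
Proof.
move=> gh; apply: linear_part_eq1.
rewrite commgEl conjgE !(linear_partM, linear_partV).
rewrite -[RHS](commg_eq1 (linear_part_comm gh)).
by rewrite commgEl conjgE.
Qed.

(** Commutators are translations, and translations commute. *)
Lemma commuting_virtually_solvable (S : set SA2Z) :
  (forall x y, S x -> S y -> theta x *m theta y = theta y *m theta x) ->
  virtually_solvable (generated_subgroup S).
Proof.
move=> SS; set H := generated_subgroup S.
have centg (A : set SA2Z) : is_subgroup
    [set x | forall y, A y -> theta x *m theta y = theta y *m theta x].
  split=> [y _|x z xA zA y Ay]; first by rewrite theta1 mul1mx mulmx1.
  rewrite thetaM thetaV -mulmxA.
  have -> : invmx (theta z) *m theta y = theta y *m invmx (theta z).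
    have zu := theta_unit z.
    rewrite -[LHS](mulmxK zu) -(mulmxA (invmx (theta z))) -(zA y Ay).
    by rewrite (mulmxA (invmx (theta z))) mulVmx // mul1mx.
  by rewrite !mulmxA (xA y Ay).
have HS x y : H x -> S y -> theta x *m theta y = theta y *m theta x.
  by move=> Hx; apply: (generated_sub (centg S) _ Hx) => z Sz w; apply: SS.
have HH x y : H x -> H y -> theta x *m theta y = theta y *m theta x.
  move=> Hx; apply: (generated_sub (centg H) _ Hx) => z Sz w Hw.
  exact/esym/HS.
have Tg := subgroup_translations.
apply: (solvable_subgroup_chain (subgroup_generated S) Tg Tg (fun _ => id)).
- by move=> x y Hx Hy; apply/comm_translations/HH.
- by move=> x y Tx Ty; rewrite translations_commute //; case: Tg.
- exact: translations_commute.
Qed.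

(** For hyperbolic [g], these are the elements whose linear part preserves or
    exchanges the eigenlines of [g]. *)
Definition axis_stabilizer g : set SA2Z :=
  [set x | (linear_part g ^ linear_part x)%g = linear_part g
        \/ (linear_part g ^ linear_part x)%g = (linear_part g)^-1%g].

Lemma subgroup_axis_stabilizer g : is_subgroup (axis_stabilizer g).
Proof.
split=> [|x y]; first by left; rewrite linear_part1 conjg1.
rewrite /axis_stabilizer /= linear_partM linear_partV !conjgM => xg yg.
have : (linear_part g ^ (linear_part y)^-1)%g = linear_part g
    \/ (linear_part g ^ (linear_part y)^-1)%g = (linear_part g)^-1%g.
  case: yg => yg; [left|right]; apply: (conjg_inj (linear_part y)).
    by rewrite conjgKV.
  by rewrite conjgKV conjVg yg invgK.
by case: xg => ->; case=> e; rewrite ?conjVg e ?invgK; [left|right|right|left].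
Qed.

(** Commutators in the stabilizer centralize the linear part of [g]; the linear
    parts of that centralizer commute with one another. *)
Lemma axis_stabilizer_virtually_solvable g (S : set SA2Z) :
  4 < (\tr (theta g)) ^+ 2 -> S `<=` axis_stabilizer g ->
  virtually_solvable (generated_subgroup S).
Proof.
move=> trg Sg.
set C : set SA2Z := [set x | (linear_part g ^ linear_part x)%g = linear_part g].
have Cg : is_subgroup C.
  split=> [|x y]; first by rewrite /C /= linear_part1 conjg1.
  rewrite /C /= linear_partM linear_partV conjgM => -> yg.
  by rewrite -{1}yg conjgK.
have Cth x : C x -> theta g *m theta x = theta x *m theta g.
  rewrite /C /= conjgE => xg.
  have : (linear_part x * linear_part g = linear_part g * linear_part x)%g.
    by rewrite -{1}xg mulVKg.
  by move=> /(congr1 theta).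
have Tg := subgroup_translations.
apply: (solvable_subgroup_chain (subgroup_generated S) Cg Tg
  (generated_sub (subgroup_axis_stabilizer g) Sg)) => [x y|x y Cx Cy|].
- rewrite /axis_stabilizer /C /= => xg yg.
  have xg' : (linear_part g ^ (linear_part x)^-1)%g =
      (linear_part g ^ linear_part x)%g.
    case: xg => e; rewrite e; apply: (conjg_inj (linear_part x)).
      by rewrite conjgKV.
    by rewrite conjgKV conjVg e invgK.
  have yg' : (linear_part g ^ (linear_part y)^-1)%g =
      (linear_part g ^ linear_part y)%g.
    case: yg => e; rewrite e; apply: (conjg_inj (linear_part y)).
      by rewrite conjgKV.
    by rewrite conjgKV conjVg e invgK.
  rewrite commgEl conjgE !(linear_partM, linear_partV) !conjgM xg'.
  case: xg => e; case: yg yg' => f f'.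
  + by rewrite e f' f e f.
  + by rewrite e f' f conjVg e conjVg f invgK.
  + by rewrite e conjVg f' f conjVg e invgK f.
  + by rewrite e conjVg f' f invgK e conjVg f invgK.
- apply: comm_translations.
  by apply: (centralizer_commutative (det_theta g) trg); apply: Cth.
- exact: translations_commute.
Qed.

End LinearPart.

(** * Choice of the conjugating power *)

Section Frame.
Variable R : realFieldType.

(** [a] agrees with [b t] or with [b / t] up to a factor 2; for the latter,
    the inequalities are multiplied by [t]. *)
Definition comparable_scales (a b t : R) :=
  (a <= 2 * (b * t)) && (b * t <= 2 * a)
  || (a * t <= 2 * b) && (b <= 2 * (a * t)).

(** The scales [b t], [b / t], [b t'] and [b / t'] differ by factors of at least
    46, so [a] is close to at most one of them. *)
Lemma comparable_scales_unique (a b t t' : R) : 0 < a -> 0 < b ->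
  46 <= t -> 46 * t <= t' ->
  comparable_scales a b t -> comparable_scales a b t' -> False.
Proof.
move=> a0 b0 t_ge t'_ge.
have bt : 46 * (b * t) <= b * t' by rewrite mulrCA ler_pM2l.
have at_ : 46 * (a * t) <= a * t' by rewrite mulrCA ler_pM2l.
have b_le : 46 * b <= b * t by rewrite mulrC ler_pM2l.
have a_le : 46 * a <= a * t by rewrite mulrC ler_pM2l.
by case/orP=> /andP[h1 h2] /orP[] /andP[h3 h4]; lra.
Qed.

(** Cancellation in a sum requires summands of comparable size. *)
Lemma incomparable_add_ge (x y t : R) : 0 < t ->
  ~~ comparable_scales `|x| `|y| t ->
  `|x| + `|y| * t <= 6 * `|x + y * t| /\ `|x| + `|y| / t <= 6 * `|x + y / t|.
Proof.
move=> t0; rewrite negb_or => /andP[n1 n2].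
have main z : (`|x| <= 2 * `|z|) && (`|z| <= 2 * `|x|) = false ->
    `|x| + `|z| <= 6 * `|x + z|.
  move=> h; rewrite leNgt; apply/negP => lt.
  have := lerB_dist x (- z); have := lerB_dist z (- x).
  rewrite !normrN !opprK (addrC z) => h1 h2.
  by move: h; rewrite (_ : _ && _ = true) //; apply/andP; split; lra.
have normt z : `|z * t| = `|z| * t by rewrite normrM (gtr0_norm t0).
have normtV z : `|z / t| = `|z| / t by rewrite normrM normfV (gtr0_norm t0).
split.
  by rewrite -normt; apply: main; rewrite normt; apply: negbTE.
rewrite -normtV; apply: main; rewrite normtV; apply: negbTE.
apply: contra n2 => /andP[h1 h2].
rewrite mulrA ler_pdivlMr // in h1; rewrite ler_pdivrMr // -mulrA in h2.
by rewrite h1.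
Qed.

Variables (l k z y : R).
Hypothesis l_ge : 46 <= l.
Hypotheses (k_le : `|k| <= l ^+ 3) (k_ge : 1 <= `|k| * l ^+ 3).
Hypotheses (z0 : z != 0) (y0 : y != 0) (zy1 : `|z| + `|y| = 1).

Let l0 : 0 < l. Proof. by move: l_ge; lra. Qed.
Let l1 : 1 <= l. Proof. by move: l_ge; lra. Qed.
Let k0 : 0 < `|k|.
Proof.
rewrite normr_gt0; apply: contraTneq k_ge => ->.
by rewrite normr0 mul0r -ltNge.
Qed.

(** Each of the two resonances excludes at most one of the three exponents. *)
Lemma good_exponent : exists d : nat, [/\ (5 <= d)%N, (d <= 7)%N,
  ~~ comparable_scales `|z| `|y| (l ^+ d)
  & ~~ comparable_scales `|z| `|k * y| (l ^+ d)].
Proof.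
have uniq_exp b m n : 0 < b -> (5 <= m < n)%N ->
    comparable_scales `|z| b (l ^+ m) -> comparable_scales `|z| b (l ^+ n) ->
    False.
  move=> b0 /andP[m5 mn]; apply: comparable_scales_unique => //.
  - by rewrite normr_gt0.
  - apply: le_trans l_ge _.
    by rewrite -[leLHS]expr1 ler_weXn2l // (leq_trans _ m5).
  - apply: (@le_trans _ _ (l ^+ m.+1)); last by rewrite ler_weXn2l.
    by rewrite exprS ler_pM2r // exprn_gt0.
have y_gt0 : 0 < `|y| by rewrite normr_gt0.
have ky_gt0 : 0 < `|k * y| by rewrite normrM mulr_gt0.
have u m n mn := uniq_exp `|y| m n y_gt0 mn.
have v m n mn := uniq_exp `|k * y| m n ky_gt0 mn.
pose P m := comparable_scales `|z| `|y| (l ^+ m).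
pose Q m := comparable_scales `|z| `|k * y| (l ^+ m).
have [|n5] := boolP (~~ P 5%N && ~~ Q 5%N).
  by case/andP; exists 5%N.
have [|n6] := boolP (~~ P 6%N && ~~ Q 6%N).
  by case/andP; exists 6%N.
exists 7%N; split=> //; apply/negP => h7.
  have /negP p5 : ~ P 5%N by move=> h5; apply: (u 5%N 7%N _ h5 h7).
  have /negP p6 : ~ P 6%N by move=> h6; apply: (u 6%N 7%N _ h6 h7).
  move: n5 n6; rewrite p5 p6 /= !negbK => q5 q6.
  exact: (v 5%N 6%N _ q5 q6).
have /negP q5 : ~ Q 5%N by move=> h5; apply: (v 5%N 7%N _ h5 h7).
have /negP q6 : ~ Q 6%N by move=> h6; apply: (v 6%N 7%N _ h6 h7).
move: n5 n6; rewrite q5 q6 !andbT !negbK => p5 p6.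
exact: (u 5%N 6%N _ p5 p6).
Qed.

Variable d : nat.
Hypotheses (d5 : (5 <= d)%N) (d7 : (d <= 7)%N).
Hypothesis dy : ~~ comparable_scales `|z| `|y| (l ^+ d).
Hypothesis dky : ~~ comparable_scales `|z| `|k * y| (l ^+ d).

Let t := l ^+ d.
(** In the normalized frame, where the hyperbolic map is diag(l, 1/l), the
    eigenlines of its first conjugate have directions (1, 1) and (k, 1), and
    the fixed point of that conjugate is (z, y).  Applying diag(t, 1/t) gives
    the data of the second conjugate. *)
Definition frame_coef (s : letter) : R := if s.2 then 1 else k.
Definition frame1 (s : letter) : R := frame_coef s * (if s.1 then 1 else t).
Definition frame2 (s : letter) : R := if s.1 then 1 else t^-1.
Definition center1 (i : bool) : R := if i then z else t * z.
Definition center2 (i : bool) : R := if i then y else t^-1 * y.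

Let K := l ^+ 10.

Let t0 : 0 < t. Proof. exact: exprn_gt0. Qed.
Let t_ge1 : 1 <= t. Proof. exact: exprn_ege1. Qed.
Let tV_le1 : t^-1 <= 1. Proof. by rewrite invf_le1. Qed.
Let tV0 : 0 < t^-1. Proof. by rewrite invr_gt0. Qed.
Let t_le : t <= l ^+ 7. Proof. by rewrite ler_weXn2l. Qed.
Let t_ge : l ^+ 5 <= t. Proof. by rewrite ler_weXn2l. Qed.
Let l2_ge : 2116 <= l ^+ 2.
Proof.
by have : 46 * 46 <= l * l; [rewrite ler_pM | rewrite expr2; lra].
Qed.

Let coef_le s : `|frame_coef s| <= l ^+ 3.
Proof. by rewrite /frame_coef; case: s.2; rewrite ?normr1 // exprn_ege1. Qed.
Let coef_ge s : 1 <= `|frame_coef s| * l ^+ 3.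
Proof.
by rewrite /frame_coef; case: s.2; rewrite // normr1 mul1r exprn_ege1.
Qed.

Let coef_t_ge s : 2116 <= `|frame_coef s| * t.
Proof.
apply: le_trans l2_ge _.
apply: (@le_trans _ _ (`|frame_coef s| * l ^+ 5)); last by rewrite ler_wpM2l.
by rewrite (exprD l 3 2) mulrA ler_peMl // exprn_ge0 // ltW.
Qed.

Let coef_tV_le s : `|frame_coef s| / t <= 1.
Proof.
rewrite ler_pdivrMr // mul1r; apply: le_trans (coef_le s) _.
by apply: le_trans t_ge; rewrite ler_weXn2l.
Qed.

Lemma K_ge600 : 600 <= K.
Proof.
by apply: (@le_trans _ _ (l ^+ 2)); [move: l2_ge; lra|rewrite ler_weXn2l].
Qed.

Lemma frame1_le s : `|frame1 s| <= K.
Proof.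
rewrite normrM /K (exprD l 3 7) ler_pM //.
by case: s.1; rewrite ?normr1 ?exprn_ege1 // (gtr0_norm t0).
Qed.

Lemma frame2_le s : `|frame2 s| <= K.
Proof.
apply: (@le_trans _ _ 1); last by rewrite exprn_ege1.
by rewrite /frame2; case: s.1; rewrite ?normr1 // gtr0_norm.
Qed.

Lemma frame_ge s : 1 <= `|frame1 s| \/ 1 <= `|frame2 s|.
Proof.
rewrite /frame1 /frame2; case: s.1; first by right; rewrite normr1.
by left; rewrite normrM (gtr0_norm t0); have := coef_t_ge s; lra.
Qed.

Lemma center1_le i : `|center1 i| <= K.
Proof.
have z_le : `|z| <= 1 by have := normr_ge0 y; move: zy1; lra.
apply: (@le_trans _ _ (l ^+ 7)); last by rewrite ler_weXn2l.
case: i; first by apply: le_trans z_le _; rewrite exprn_ege1.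
by rewrite normrM (gtr0_norm t0) -[leRHS]mulr1 ler_pM // ltW.
Qed.

Lemma center2_le i : `|center2 i| <= K.
Proof.
have y_le : `|y| <= 1 by have := normr_ge0 z; move: zy1; lra.
apply: (@le_trans _ _ 1); last by rewrite exprn_ege1.
case: i => //; rewrite normrM (gtr0_norm tV0) -[leRHS]mulr1 ler_pM //.
exact: ltW.
Qed.

Lemma frame_transverse s r : s.1 != r.1 ->
  1 <= `|frame1 s * frame2 r - frame2 s * frame1 r|.
Proof.
have main u v : 1 <= `|frame_coef u * t^-1 - frame_coef v * t|.
  have := lerB_dist (frame_coef v * t) (frame_coef u * t^-1).
  rewrite distrC !normrM normfV (gtr0_norm t0).
  by have := coef_t_ge v; have := coef_tV_le u; lra.
rewrite /frame1 /frame2; case: s.1; case: r.1 => // _.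
  by rewrite mulr1 mul1r.
by rewrite !mulr1 distrC [t^-1 * _]mulrC.
Qed.

(** Up to factors near 1 and t, the determinant is [z + c y / t] or
    [z + c y t] with [c] equal to 1 or to [k]: it is large because [d] avoids
    the resonances. *)
Lemma center_transverse s :
  1 <= K * `|(center1 true - center1 false) * frame2 s
            - (center2 true - center2 false) * frame1 s|.
Proof.
set c := frame_coef s.
have [cy_t cy_tV] : `|z| + `|c * y| * t <= 6 * `|z + c * y * t|
    /\ `|z| + `|c * y| / t <= 6 * `|z + c * y / t|.
  apply: incomparable_add_ge => //; rewrite /c /frame_coef.
  by case: s.2; rewrite ?mul1r.
have low : 1 <= l ^+ 3 * (`|z| + `|c * y|).
  rewrite mulrDr normrM mulrA [l ^+ 3 * `|c|]mulrC -zy1 lerD //.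
    by rewrite ler_peMl // exprn_ege1.
  by rewrite ler_peMl // coef_ge.
have t_2116 : 2116 <= t.
  by apply: le_trans l2_ge _; rewrite ler_weXn2l // (leq_trans _ d5).
have t2 : t / 2 <= t - 1 by lra.
have z_ge0 := normr_ge0 z; have cy_ge0 := normr_ge0 (c * y).
have big : 12 * l ^+ 3 <= K.
  rewrite /K (exprD l 7 3) ler_wpM2r //; first by rewrite exprn_ge0 // ltW.
  by apply: (@le_trans _ _ (l ^+ 2)); [move: l2_ge; lra|rewrite ler_weXn2l].
suff main (w : R) : `|z| + `|c * y| <= 12 * `|w| -> 1 <= K * `|w|.
  apply: main; rewrite /center1 /center2 /frame1 /frame2 -/c.
  case: s.1.
    rewrite (_ : _ - _ = - ((t - 1) * (z + c * y / t))); last first.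
      by field; rewrite gt_eqF.
    rewrite normrN (normrM (t - 1)) (ger0_norm (_ : 0 <= t - 1)) ?subr_ge0 //.
    have h : t * (`|z| + `|c * y| / t) = t * `|z| + `|c * y|.
      by field; rewrite gt_eqF.
    have : t * `|z| + `|c * y| <= t * (6 * `|z + c * y / t|).
      by rewrite -h ler_pM2l.
    have : t / 2 * `|z + c * y / t| <= (t - 1) * `|z + c * y / t|.
      by rewrite ler_wpM2r.
    have : 1 * `|z| <= t * `|z| by rewrite ler_wpM2r.
    lra.
  rewrite (_ : _ - _ = - ((t - 1) / t * (z + c * y * t))); last first.
    by field; rewrite gt_eqF.
  rewrite normrN (normrM ((t - 1) / t)).
  have t3 : 1 / 2 <= `|(t - 1) / t|.
    rewrite ger0_norm; first by rewrite ler_pdivlMr //; lra.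
    by rewrite divr_ge0 ?subr_ge0 // ltW.
  have : 1 / 2 * `|z + c * y * t| <= `|(t - 1) / t| * `|z + c * y * t|.
    by rewrite ler_wpM2r.
  have : `|c * y| * 1 <= `|c * y| * t by rewrite ler_wpM2l.
  lra.
move=> h; apply: le_trans low _.
apply: (@le_trans _ _ (l ^+ 3 * (12 * `|w|))).
  by rewrite ler_wpM2l // exprn_ge0 // ltW.
by rewrite mulrCA mulrA ler_wpM2r.
Qed.

End Frame.

(** * Eigenframe of an integral hyperbolic map *)

Lemma no_rational_eigenvector (p q r s : int) (x y : rat) :
  p * s - q * r = 1 -> 4 < (p + s) ^+ 2 ->
  r%:~R * x ^+ 2 + (s - p)%:~R * x * y - q%:~R * y ^+ 2 = 0 ->
  x = 0 /\ y = 0.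
Proof.
move=> d1 tr4 e; set c : rat := (denq x)%:~R * (denq y)%:~R.
have c0 : c != 0 by rewrite mulf_neq0 // intr_eq0 denq_neq0.
have [m mE] : exists m : int, m%:~R = x * c.
  by exists (numq x * denq y); rewrite intrM numqE mulrA.
have [n nE] : exists n : int, n%:~R = y * c.
  by exists (numq y * denq x); rewrite intrM numqE mulrAC mulrA.
have [] := @no_integer_eigenvector p q r s m n d1 tr4.
  apply: (@intr_inj rat).
  rewrite !(rmorphD, rmorphB, rmorphM, rmorphN, rmorphXn) /= mE nE.
  rewrite [RHS](_ : _ = c ^+ 2 *
   (r%:~R * x ^+ 2 + (s - p)%:~R * x * y - q%:~R * y ^+ 2)).
    by rewrite rmorphB /=; ring.
  by rewrite e mulr0.
move=> m0 n0; split; apply: (mulIf c0).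
  by rewrite -mE m0 mul0r.
by rewrite -nE n0 mul0r.
Qed.

Section CommutatorDet.
Variables g k : SA2Z.
Hypothesis trg : 4 < (\tr (theta g)) ^+ 2.

Lemma commutator_det_neq0 : theta g *m theta k <> theta k *m theta g ->
  \det (theta g *m theta k - theta k *m theta g) != 0.
Proof.
move=> ngk; apply/eqP => /(intertwiner_singular_eq0 (det_theta g) trg) C0.
apply: ngk; apply/eqP; rewrite -subr_eq0; apply/eqP.
apply: (C0 (invmx (theta g))).
have [i00 i01 i10 i11] := invmx2 (det_theta g).
apply: matrix2P; rewrite !mulmx2 !mxE !sum_ord2 ?i00 ?i01 ?i10 ?i11; ring.
Qed.

Lemma inversion_det_neq0 :
  theta g *m theta k <> theta k *m invmx (theta g) ->
  \det (theta g *m theta k - theta k *m invmx (theta g)) != 0.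
Proof.
move=> ngk; apply/eqP => /(intertwiner_singular_eq0 (det_theta g) trg) C0.
apply: ngk; apply/eqP; rewrite -subr_eq0; apply/eqP.
apply: (C0 (theta g)).
have [i00 i01 i10 i11] := invmx2 (det_theta g).
apply: matrix2P; rewrite !mulmx2 !mxE !sum_ord2 ?i00 ?i01 ?i10 ?i11; ring.
Qed.

End CommutatorDet.

Section AffineMaps.
Variable R : realType.
Implicit Types (g h k : SA2Z) (x y : 'cV[R]_2).

Definition realmx g : 'M[R]_2 := map_mx intr (theta g).

Lemma affine_map_sub g x y :
  affine_map g x - affine_map g y = realmx g *m (x - y).
Proof. by rewrite /affine_map mulmxBr opprD addrACA subrr addr0. Qed.

Lemma affine_map_rational g (q : 'cV[rat]_2) :
  exists q' : 'cV[rat]_2,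
    affine_map g (map_mx ratr q : 'cV[R]_2) = map_mx ratr q'.
Proof.
exists (map_mx intr (theta g) *m q + map_mx intr (tau g)).
rewrite map_mxD map_mxM -!map_mx_comp /affine_map.
by congr (_ *m _ + _); apply/matrixP => i j; rewrite !mxE /= ratr_int.
Qed.

(** 1 - theta g has determinant 2 - tr (theta g), which is nonzero. *)
Lemma hyperbolic_fixed_point g : 4 < (\tr (theta g)) ^+ 2 ->
  exists2 q : 'cV[rat]_2, rational_points (map_mx ratr q : 'cV[R]_2)
    & affine_map g (map_mx ratr q : 'cV[R]_2) = map_mx ratr q.
Proof.
move=> trg; pose N : 'M[rat]_2 := 1%:M - map_mx intr (theta g).
have detN : \det N = (2 - \tr (theta g))%:~R.
  have := congr1 (fun z : int => z%:~R : rat) (det_theta g).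
  rewrite !det2 tr2 /= !mxE /= !(rmorphB, rmorphM, rmorphD) /= => e.
  rewrite mulr1n mulr0n !sub0r; rewrite [RHS](_ : _ = 1 - (theta g 0 0)%:~R
    - (theta g 1 1)%:~R + 1%:~R); last by ring.
  by rewrite -e; ring.
have Nu : N \in unitmx.
  rewrite unitmxE detN unitfE intr_eq0 subr_eq0.
  by apply: contraTneq trg => <-.
exists (invmx N *m map_mx intr (tau g)); first by eexists.
set q := _ *m _.
have qE : q = map_mx intr (theta g) *m q + map_mx intr (tau g).
  have : N *m q = map_mx intr (tau g) by rewrite mulKVmx.
  by rewrite mulmxBl mul1mx => <-; rewrite addrC subrK.
clearbody q; rewrite [in RHS]qE map_mxD map_mxM -!map_mx_comp /affine_map.
by congr (_ *m _ + _); apply/matrixP => i j; rewrite !mxE /= ratr_int.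
Qed.

End AffineMaps.

Section Eigenframe.
Variables (R : realType) (g k : SA2Z) (o : 'cV[rat]_2).
Let T := \tr (theta g).
Hypothesis T_ge : 47 <= T.
Hypothesis gk : theta g *m theta k <> theta k *m theta g.
Hypothesis gk' : theta g *m theta k <> theta k *m invmx (theta g).
Let o' : 'cV[R]_2 := map_mx ratr o.
Hypothesis go : affine_map g o' = o'.
Hypothesis ko : affine_map k o' <> o'.

Let TR : R := T%:~R.
Definition eigval : R := (TR + Num.sqrt (TR ^+ 2 - 4)) / 2.
Let l := eigval.
Let m := l^-1.

Let TR_ge : 47 <= TR.
Proof. by rewrite -[47]/(47%:~R) ler_int. Qed.

Lemma eigval_ge : 46 <= l.
Proof.
have : 45 <= Num.sqrt (TR ^+ 2 - 4).
  rewrite -[45]gtr0_norm // -sqrtr_sqr ler_sqrt; last first.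
    by have := TR_ge; nra.
  by have := TR_ge; nra.
by rewrite /l /eigval; have := TR_ge; lra.
Qed.

Let l0 : 0 < l. Proof. by have := eigval_ge; lra. Qed.

Let l_root : l * (TR - l) = 1.
Proof.
have : Num.sqrt (TR ^+ 2 - 4) ^+ 2 = TR ^+ 2 - 4.
  by rewrite sqr_sqrtr //; have := TR_ge; nra.
by rewrite /l /eigval; set w := Num.sqrt _; move=> wE; lra.
Qed.

Let mE : m = TR - l.
Proof. by apply: (mulfI (lt0r_neq0 l0)); rewrite l_root mulfV // lt0r_neq0. Qed.

Let lm : l * m = 1. Proof. by rewrite mE. Qed.
Let m_small : m <= 46^-1.
Proof. by rewrite lef_pV2 // ?posrE // eigval_ge. Qed.

(** The rows are left eigenvectors, i.e. the linear coordinates that [g]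
    multiplies by [l] and [m]. *)
Definition eigen_rows : 'M[R]_2 :=
  \matrix_(i, j) (if j == 0 then realmx R g 1 0
                  else (if i == 0 then l else m) - realmx R g 0 0).
Let P := eigen_rows.
Let D : 'M[R]_2 := \matrix_(i, j)
  (if i == j then if i == 0 then l else m else 0).

Let trR : realmx R g 0 0 + realmx R g 1 1 = TR.
Proof. by rewrite /TR /T tr2 !mxE intrD. Qed.

Let det_realmx h : \det (realmx R h) = 1.
Proof. by rewrite det_map_mx det_theta. Qed.

Let PG : P *m realmx R g = D *m P.
Proof.
have := det_realmx g; rewrite det2 => g1.
have s : realmx R g 1 1 = l + m - realmx R g 0 0.
  by rewrite mE addrC -trR; ring.
have e : realmx R g 0 1 * realmx R g 1 0
    = realmx R g 0 0 * (l + m - realmx R g 0 0) - l * m.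
  by rewrite lm -s -g1; ring.
apply: matrix2P; rewrite !mulmx2 ![P _ _]mxE ![D _ _]mxE /= ?s.
- by ring.
- by rewrite [X in X + _]mulrC e; ring.
- by ring.
- by rewrite [X in X + _]mulrC e; ring.
Qed.

Let trg4 : 4 < (\tr (theta g)) ^+ 2.
Proof.
rewrite -/T expr2; apply: lt_le_trans (_ : 47 * 47 <= _) => //.
by rewrite ler_pM.
Qed.

Let m0 : 0 < m. Proof. by rewrite invr_gt0. Qed.
Let lm_neq : l - m != 0.
Proof.
by rewrite gt_eqF // subr_gt0; have := eigval_ge; have := m_small; lra.
Qed.

Let r_neq0 : realmx R g 1 0 != 0.
Proof.
rewrite mxE intr_eq0; apply/eqP => r0.
have := det_theta g; rewrite det2 => g1; have tr4 := trg4; rewrite tr2 in tr4.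
have [] // := no_integer_eigenvector (x := 1) (y := 0) g1 tr4.
by rewrite r0; ring.
Qed.

Let det_P : \det P = - (realmx R g 1 0 * (l - m)).
Proof. by rewrite det2 ![P _ _]mxE /=; ring. Qed.

Let P_unit : P \in unitmx.
Proof. by rewrite unitmxE unitfE det_P oppr_eq0 mulf_neq0. Qed.

(* The matrix of k in the eigenframe. *)
Let k' := P *m realmx R k *m invmx P.
Let k'P : k' *m P = P *m realmx R k. Proof. exact: mulmxKV. Qed.

Let det_k' : \det k' = 1.
Proof.
apply: (mulIf (_ : \det P != 0)).
  by rewrite det_P oppr_eq0 mulf_neq0.
by rewrite -det_mulmx k'P det_mulmx det_realmx mulr1 mul1r.
Qed.

Let realmxM h h' :
  realmx R h *m realmx R h' = map_mx intr (theta h *m theta h').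
Proof. by rewrite map_mxM. Qed.

(* g k - k g becomes antidiagonal in the eigenframe, with entries
   (l - m) k'_01 and (m - l) k'_10. *)
Let beta_gamma : (k' 0 1 * k' 1 0) * (l - m) ^+ 2
  = (\det (theta g *m theta k - theta k *m theta g))%:~R.
Proof.
move: k' k'P => h hP; rewrite -det_map_mx map_mxB -!realmxM.
apply: (mulIf (_ : \det P != 0)).
  by rewrite det_P oppr_eq0 mulf_neq0.
rewrite [RHS]mulrC -!det_mulmx mulmxBr !mulmxA PG -hP -!mulmxA PG -hP.
rewrite !mulmxA -mulmxBl det_mulmx; congr (_ * _).
by rewrite [RHS]det2 !mxE !sum_ord2 ![D _ _]mxE /=; ring.
Qed.

(* g k - k g^-1 becomes diagonal in the eigenframe, with entries
   (l - m) k'_00 and (m - l) k'_11. *)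
Let alpha_delta : (k' 0 0 * k' 1 1) * (l - m) ^+ 2
  = - (\det (theta g *m theta k - theta k *m invmx (theta g)))%:~R.
Proof.
pose D' : 'M[R]_2 := \matrix_(i, j)
  (if i == j then if i == 0 then m else l else 0).
have DD' : D' *m D = 1%:M.
  apply: matrix2P; rewrite mulmx2 !mxE /= ?mulr1n ?mulr0n ?(mulrC m) ?lm;
    by ring.
have PGV : P *m map_mx intr (invmx (theta g)) = D' *m P.
  have e : realmx R g *m map_mx intr (invmx (theta g)) = 1%:M.
    by rewrite -map_mxM mulmxV ?theta_unit // map_mx1.
  by rewrite -[LHS]mul1mx -DD' -mulmxA (mulmxA D) -PG -!mulmxA e mulmx1.
move: k' k'P => h hP; apply/eqP; rewrite -eqr_oppLR; apply/eqP.
rewrite -det_map_mx map_mxB !map_mxM -!/(realmx R _).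
apply: (mulIf (_ : \det P != 0)).
  by rewrite det_P oppr_eq0 mulf_neq0.
rewrite [RHS]mulrC -!det_mulmx mulmxBr !mulmxA PG -hP -!mulmxA PGV -hP.
rewrite !mulmxA -mulmxBl det_mulmx; congr (_ * _).
by rewrite [RHS]det2 !mxE !sum_ord2 ![D _ _]mxE ![D' _ _]mxE /=; ring.
Qed.

Definition eigen_coord (x : 'cV[R]_2) : 'cV[R]_2 := P *m (x - o').
Let w := eigen_coord.

Let w_g x : w (affine_map g x) = D *m w x.
Proof.
by rewrite /w /eigen_coord -{1}go affine_map_sub !mulmxA PG.
Qed.

Let w_k x : w (affine_map k x) = w (affine_map k o') + k' *m w x.
Proof.
rewrite /w /eigen_coord mulmxA k'P -mulmxA -affine_map_sub -mulmxDr.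
by congr (_ *m _); rewrite [RHS]addrC addrA subrK.
Qed.

Let w_gX n x : w (affine_map (g ^+ n)%g x) 0 0 = l ^+ n * w x 0 0
  /\ w (affine_map (g ^+ n)%g x) 1 0 = (l ^+ n)^-1 * w x 1 0.
Proof.
elim: n => [|n [IH0 IH1]].
  by rewrite expg0 affine_map1 expr0 invr1 !mul1r.
rewrite expgS affine_mapM w_g !(mulmx2 D) IH0 IH1 ![D _ _]mxE /=.
by rewrite !mul0r addr0 add0r !mulrA exprS invfM.
Qed.

Let w_gXV n x : w (affine_map (g ^- n)%g x) 0 0 = (l ^+ n)^-1 * w x 0 0
  /\ w (affine_map (g ^- n)%g x) 1 0 = l ^+ n * w x 1 0.
Proof.
have ln0 : l ^+ n != 0 by rewrite expf_neq0 // gt_eqF.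
have := w_gX n (affine_map (g ^- n)%g x).
by rewrite -affine_mapM mulgV affine_map1 => -[-> ->]; rewrite mulKf // mulVKf.
Qed.

Let xi := w (affine_map k o') 0 0.
Let eta := w (affine_map k o') 1 0.

(* The product of the two coordinates of a vector v is, up to a nonzero factor,
   det(v, g v), and v = k o - o is rational and nonzero. *)
Let xi_eta : xi != 0 /\ eta != 0.
Proof.
apply/andP; rewrite -negb_or -mulf_eq0; apply/eqP => xe0; apply: ko.
have [q' q'E] := affine_map_rational R k o; rewrite -/o' in q'E.
pose v := q' - o.
have vE : affine_map k o' - o' = map_mx ratr v.
  by rewrite q'E /o' -map_mxB.
have := det_theta g; rewrite det2 => g1; have tr4 := trg4; rewrite tr2 in tr4.
have v0 := no_rational_eigenvector (x := v 0 0) (y := v 1 0) g1 tr4.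
suff [v00 v10] : v 0 0 = 0 /\ v 1 0 = 0.
  apply/eqP; rewrite -subr_eq0 vE; apply/eqP/matrixP => i j.
  rewrite !mxE ord1; elim/ord2_case: i.
    by move: v00; rewrite !mxE => ->; rewrite rmorph0.
  by move: v10; rewrite !mxE => ->; rewrite rmorph0.
apply: v0; apply: (fmorph_inj (ratr : rat -> R)).
rewrite rmorph0 !(rmorphD, rmorphB, rmorphM, rmorphXn, rmorphN) /= !ratr_int.
apply: (mulfI r_neq0); rewrite mulr0 -[RHS]xe0 /xi /eta /w /eigen_coord vE.
rewrite !mulmx2 ![P _ _]mxE ![map_mx ratr v _ _]mxE /=.
have -> : m = TR - l by [].
set p := realmx R g 0 0; set r := realmx R g 1 0.
have pE : (theta g 0 0)%:~R = p by rewrite /p mxE.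
have rE : (theta g 1 0)%:~R = r by rewrite /r mxE.
have sE : (theta g 1 1)%:~R = TR - p by rewrite -trR -pE !mxE addrC addKr.
have qE : (theta g 0 1)%:~R * r = p * (TR - p) - 1.
  have := congr1 (intr : int -> R) g1.
  by rewrite rmorphB !rmorphM /= rE pE sE rmorph1 => g1R; lra.
rewrite ?rmorphB /= pE rE sE.
have l2 : l * (TR - l) = 1 := l_root.
set x := ratr (v 0 0); set y := ratr (v 1 0).
transitivity (r ^+ 2 * x ^+ 2 + (TR - p - p) * r * x * y
    - (theta g 0 1)%:~R * r * y ^+ 2); first by ring.
rewrite qE -[X in _ - (_ - X) * _]l2; ring.
Qed.

Let L2_le : (l - m) ^+ 2 <= l ^+ 2.
Proof.
by rewrite ler_sqr ?nnegrE; have := m_small; have := m0; have := eigval_ge; lra.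
Qed.

Let int_ge1 (z : int) : z != 0 -> 1 <= `|z%:~R : R|.
Proof.
by move=> z0; rewrite -intr_norm -[1]/(1%:~R) ler_int -gtz0_ge1 normr_gt0.
Qed.

Let beta_gamma_ge : 1 <= `|k' 0 1 * k' 1 0| * l ^+ 2.
Proof.
have := int_ge1 (commutator_det_neq0 trg4 gk); rewrite -beta_gamma normrM.
move=> /le_trans; apply; rewrite (ger0_norm (sqr_ge0 _)).
by rewrite ler_wpM2l.
Qed.

Let alpha_delta_ge : 1 <= `|k' 0 0 * k' 1 1| * l ^+ 2.
Proof.
have := int_ge1 (inversion_det_neq0 trg4 gk').
rewrite -normrN -alpha_delta normrM.
move=> /le_trans; apply; rewrite (ger0_norm (sqr_ge0 _)).
by rewrite ler_wpM2l.
Qed.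

Let neq0_of_ge (x y : R) : 1 <= `|x * y| * l ^+ 2 -> x != 0 /\ y != 0.
Proof.
move=> xy_ge; apply/andP; rewrite -negb_or -mulf_eq0.
by apply: contraTneq xy_ge => ->; rewrite normr0 mul0r -ltNge.
Qed.

(* The ratio of k'_10 / k'_00 to k'_11 / k'_01, the slopes of the eigenlines of
   k g k^-1. *)
Let kappa := k' 0 1 * k' 1 0 / (k' 0 0 * k' 1 1).

(* With b = k'_01 k'_10 the ratio is b / (b + 1), where b and b + 1 are both at
   least l^-2 in absolute value; b may be arbitrarily large. *)
Let kappa_bounds : `|kappa| <= l ^+ 3 /\ 1 <= `|kappa| * l ^+ 3.
Proof.
rewrite /kappa normrM normfV.
move: beta_gamma_ge alpha_delta_ge; have := det_k'; rewrite det2.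
set a := k' 0 0 * k' 1 1; set b := k' 0 1 * k' 1 0 => ab1 b_ge a_ge.
have a0 : 0 < `|a|.
  rewrite normr_gt0; apply: contraTneq a_ge => ->.
  by rewrite normr0 mul0r -ltNge.
have aE : a = b + 1 by rewrite -ab1 addrC subrK.
have a_le : `|a| <= `|b| + 1.
  by rewrite aE; apply: le_trans (ler_normD _ _) _; rewrite normr1.
have b_le : `|b| <= `|a| + 1.
  rewrite (_ : b = a - 1); last by rewrite aE addrK.
  by apply: le_trans (ler_normB _ _) _; rewrite normr1.
have l3 : 46 * l ^+ 2 <= l ^+ 3.
  by rewrite [leRHS]exprS ler_wpM2r ?sqr_ge0 // eigval_ge.
have l2 : 1 <= l ^+ 2 by rewrite exprn_ege1 //; have := eigval_ge; lra.
have big c : 0 <= c -> 1 <= c * l ^+ 2 -> c + 1 <= c * l ^+ 3.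
  move=> c0 c_ge.
  have : c * (46 * l ^+ 2) <= c * l ^+ 3 by rewrite ler_wpM2l.
  have : c * 1 <= c * l ^+ 2 by rewrite ler_wpM2l.
  lra.
split.
  rewrite ler_pdivrMr // [leRHS]mulrC; apply: le_trans b_le _.
  by apply: big => //; apply: ltW.
rewrite mulrAC ler_pdivlMr // mul1r; apply: le_trans a_le _.
exact: big.
Qed.

(* Multiplying the first coordinate by sigma gives the expanding line of
   k g k^-1 slope 1, and dividing by M normalizes its fixed point. *)
Let sigma := k' 1 0 / k' 0 0.
Let M := `|sigma * xi| + `|eta|.
Let zeta := sigma * xi / M.
Let rho := eta / M.

Let k'_neq0 : [/\ k' 0 0 != 0, k' 1 1 != 0, k' 0 1 != 0 & k' 1 0 != 0].
Proof.
have [? ?] := neq0_of_ge beta_gamma_ge.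
by have [? ?] := neq0_of_ge alpha_delta_ge; split.
Qed.

Let M_gt0 : 0 < M.
Proof. by rewrite ltr_wpDl // normr_gt0; case: xi_eta. Qed.

Let zeta_neq0 : zeta != 0.
Proof.
have [a0 d0 b0 c0] := k'_neq0; have [x0 e0] := xi_eta.
by rewrite !mulf_neq0 ?invr_eq0 // gt_eqF.
Qed.

Let rho_neq0 : rho != 0.
Proof. by have [x0 e0] := xi_eta; rewrite mulf_neq0 ?invr_eq0 // gt_eqF. Qed.

Let norm1 : `|zeta| + `|rho| = 1.
Proof.
rewrite (normrM (sigma * xi)) (normrM eta) normfV (gtr0_norm M_gt0) -mulrDl.
by rewrite mulfV // gt_eqF.
Qed.

Definition axis_conj (d : nat) (i : bool) : SA2Z :=
  if i then k else (g ^+ d * k)%g.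

Definition axis_power (d : nat) (i : bool) : SA2Z :=
  (axis_conj d i * g ^+ 70 * (axis_conj d i)^-1)%g.

(** The general position constant is K = l^10, and A = l^70 = K^7. *)
Lemma eigenframe_paradoxical : exists d : nat, (d <= 7)%N /\
  paradoxical (affine_action R) [set 1%g; axis_power d true; axis_power d false]
    4 [set: 'cV[R]_2].
Proof.
have [kappa_le kappa_ge] := kappa_bounds.
have [d [d5 d7 sy sky]] := good_exponent eigval_ge kappa_ge
  zeta_neq0 rho_neq0.
exists d; split=> //.
pose h := axis_conj d.
pose step s := affine_action R
  (letter_elt (axis_power d true) (axis_power d false) s).
pose u i x := w (affine_map (h i)^-1%g x).
pose x1 x := sigma * w x 0 0 / M.
pose x2 x := w x 1 0 / M.
pose c (s : letter) x := if s.2 then k' 1 0 / M * u s.1 x 0 0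
                         else k' 1 1 / M * u s.1 x 1 0.
have [a0 d0 b0 c0] := k'_neq0.
have M0 : M != 0 by rewrite gt_eqF.
have ln0 n : l ^+ n != 0 by rewrite expf_neq0 // gt_eqF.
have frame_k y : sigma * w (affine_map k y) 0 0 / M =
      zeta + k' 1 0 / M * w y 0 0 + k' 1 1 / M * w y 1 0 * kappa
    /\ w (affine_map k y) 1 0 / M =
      rho + k' 1 0 / M * w y 0 0 + k' 1 1 / M * w y 1 0.
  rewrite w_k; split.
    rewrite mxE (mulmx2 k') -/xi /zeta /kappa /sigma; field.
    by rewrite a0 d0 M0.
  by rewrite mxE (mulmx2 k') -/eta /rho; field.
have frame_true x : x1 x = zeta + k' 1 0 / M * u true x 0 0
        + k' 1 1 / M * u true x 1 0 * kappa
    /\ x2 x = rho + k' 1 0 / M * u true x 0 0 + k' 1 1 / M * u true x 1 0.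
  have := frame_k (affine_map k^-1%g x).
  by rewrite -affine_mapM mulgV affine_map1.
have frame_false x : x1 x = l ^+ d * (zeta + k' 1 0 / M * u false x 0 0
        + k' 1 1 / M * u false x 1 0 * kappa)
    /\ x2 x = (l ^+ d)^-1 *
      (rho + k' 1 0 / M * u false x 0 0 + k' 1 1 / M * u false x 1 0).
  have [<- <-] := frame_k (affine_map (h false)^-1%g x).
  have := w_gX d (affine_map k (affine_map (h false)^-1%g x)).
  rewrite -!affine_mapM ?mulgA mulgV affine_map1 /x1 /x2 => -[-> ->].
  by split; ring.
have x1E s x : x1 x = center1 l zeta d s.1 + c s x * frame1 l kappa d s
    + c (inv_letter s) x * frame1 l kappa d (inv_letter s).
  have [t1 _] := frame_true x; have [f1 _] := frame_false x.
  case: s => -[] []; rewrite /center1 /frame1 /frame_coef /c /=;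
    [rewrite t1; ring|rewrite t1; ring|rewrite f1; ring|rewrite f1; ring].
have x2E s x : x2 x = center2 l rho d s.1 + c s x * frame2 l d s
    + c (inv_letter s) x * frame2 l d (inv_letter s).
  have [_ t1] := frame_true x; have [_ f1] := frame_false x.
  case: s => -[] []; rewrite /center2 /frame2 /c /=;
    [rewrite t1; ring|rewrite t1; ring|rewrite f1; ring|rewrite f1; ring].
have u_step (s : letter) x : u s.1 (step s x) =
    w (affine_map (if s.2 then g ^+ 70 else g ^- 70)%g
        (affine_map (h s.1)^-1%g x)).
  have elt : letter_elt (axis_power d true) (axis_power d false) s =
      (h s.1 * (if s.2 then g ^+ 70 else g ^- 70) * (h s.1)^-1)%g.
    have conjV y z : ((y * z * y^-1)^-1 = y * z^-1 * y^-1 :> SA2Z)%g.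
      by rewrite !invgM invgK mulgA.
    by case: s => -[] []; rewrite /letter_elt /= /axis_power ?conjV.
  rewrite /u /step /= elt -!affine_mapM; congr (w (affine_map _ x)).
  by rewrite -!mulgA mulKg.
have c_step s x : c s (step s x) = l ^+ 70 * c s x.
  rewrite /c u_step; case: s => i [] /=.
    by have [-> _] := w_gX 70 (affine_map (h i)^-1%g x); rewrite mulrCA.
  by have [_ ->] := w_gXV 70 (affine_map (h i)^-1%g x); rewrite mulrCA.
have c_inv_step s x : c (inv_letter s) (step s x) =
    (l ^+ 70)^-1 * c (inv_letter s) x.
  rewrite /c /= u_step; case: s => i [] /=.
    by have [_ ->] := w_gX 70 (affine_map (h i)^-1%g x); rewrite mulrCA.
  by have [-> _] := w_gXV 70 (affine_map (h i)^-1%g x); rewrite mulrCA.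
have A_ge : (l ^+ 10) ^+ 7 <= l ^+ 70 by rewrite -exprM.
have K_ge := K_ge600 eigval_ge.
have e1_le := frame1_le eigval_ge kappa_le d7.
have e2_le := frame2_le eigval_ge d.
have e_ge := frame_ge eigval_ge kappa_ge d5.
have p1_le := center1_le eigval_ge norm1 d7.
have p2_le := center2_le eigval_ge norm1 d.
have e_tr := frame_transverse eigval_ge kappa_le kappa_ge d5.
have p_tr := center_transverse eigval_ge kappa_ge norm1 d5 sy sky.
apply: height_paradoxical.
  exact: (high_expands K_ge A_ge x1E x2E c_step c_inv_step p1_le p2_le
    e1_le e2_le e_ge e_tr).
exact: (low_expands K_ge A_ge x1E x2E c_step c_inv_step p1_le p2_le
    e1_le e2_le e_ge p_tr).
Qed.

End Eigenframe.

(** * Short words in a large group *)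

Lemma tr_square (h : SA2Z) :
  \tr (theta (h * h)%g) = \tr (theta h) ^+ 2 - 2.
Proof.
have := det_theta h; rewrite det2 thetaM !tr2 !mulmx2 => h1.
rewrite [RHS](_ : _ = (theta h 0 0 + theta h 1 1) ^+ 2
  - 2 * (theta h 0 0 * theta h 1 1 - theta h 0 1 * theta h 1 0)).
  by ring.
by rewrite h1 mulr1.
Qed.

Lemma tr_fourth_power (h : SA2Z) : 4 < \tr (theta h) ^+ 2 ->
  47 <= \tr (theta (h ^+ 4)%g).
Proof.
have -> : (h ^+ 4 = (h * h) * (h * h))%g by rewrite !expgS expg0 mulg1 !mulgA.
rewrite !tr_square; move: (\tr (theta h)) => t t4.
have t9 : 9 <= t ^+ 2.
  rewrite -(real_normK (num_real t)) in t4 *.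
  have : 2 < `|t| by rewrite -ltr_sqr ?nnegrE.
  by rewrite -lez1D => t3; rewrite (_ : 9 = 3 ^+ 2) // ler_sqr ?nnegrE.
have : 7 * 7 <= (t ^+ 2 - 2) * (t ^+ 2 - 2) by rewrite ler_pM //; lia.
by rewrite -expr2; lia.
Qed.

Section ShortWords.
Variable S : set SA2Z.
Hypothesis S1 : S 1%g.
Hypothesis SV : symmetric_gset S.
Hypothesis S_big : ~ virtually_solvable (generated_subgroup S).

Lemma short_hyperbolic :
  exists2 g, short_word S 4 g & 4 < \tr (theta g) ^+ 2.
Proof.
have [s [t [Ss St st]]] : exists s t, [/\ S s, S t &
    theta s *m theta t <> theta t *m theta s].
  apply: contrapT => comm.
  apply/S_big/commuting_virtually_solvable => s t Ss St.
  by apply: contrapT => st; apply: comm; exists s, t.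
have short1 := short_word1 SV.
case: (ltP 4 (\tr (theta s) ^+ 2)) => trs.
  by exists s => //; apply: (short_word_le S1 _ (short1 s Ss)).
exists (s * t * s^-1 * t^-1)%g; last exact: commutator_hyperbolic.
have short2 := short_wordM (short1 s Ss) (short1 t St).
apply: (short_wordM (m := 3) (n := 1)); last exact/short_wordV/short1.
by apply: (short_wordM (m := 2) (n := 1)) => //; exact/short_wordV/short1.
Qed.

(** A group is not the union of two proper subgroups. *)
Lemma short_outside (H K : set SA2Z) : is_subgroup H -> is_subgroup K ->
  (exists2 s, S s & ~ H s) -> (exists2 s, S s & ~ K s) ->
  exists2 k, short_word S 2 k & ~ H k /\ ~ K k.
Proof.
move=> [H1 HB] [K1 KB] [s Ss Hs] [t St Kt].
have short1 x (Sx : S x) := short_word1 SV Sx.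
have [Ks|Ks] := pselect (K s); last first.
  by exists s => //; apply: (short_word_le S1 _ (short1 s Ss)).
have [Ht|Ht] := pselect (H t); last first.
  by exists t => //; apply: (short_word_le S1 _ (short1 t St)).
exists (s * t)%g; first exact: (short_wordM (short1 s Ss) (short1 t St)).
split=> [Hst|Kst]; first by apply: Hs; rewrite -(mulgK t s); apply: HB.
apply: Kt; rewrite -[t](mulKg s) -[(s * t)%g]invgK; apply: (KB) => //.
  by rewrite -[s^-1%g]mul1g; apply: KB.
by rewrite -[(s * t)^-1%g]mul1g; apply: KB.
Qed.

End ShortWords.

Lemma subgroup_fixing (R : realType) (x : 'cV[R]_2) :
  is_subgroup [set g | affine_map g x = x].
Proof.
split=> [|g h]; first exact: affine_map1.
move=> /= gx hx; rewrite affine_mapM.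
have -> // : affine_map h^-1%g x = x.
by rewrite -{1}hx -affine_mapM mulVg affine_map1.
Qed.

Local Close Scope ring_scope.

Theorem corollary1p2 (R : realType) :
  exists N : nat,
  forall S : set SA2Z,
    finite_set S ->
    symmetric_gset S ->
    S 1%g ->
    ~ virtually_solvable (generated_subgroup S) ->
    ~ (exists x : 'cV[R]_2,
         rational_points x /\
         fixed_by (affine_action R) (generated_subgroup S) x) ->
    exists a b : SA2Z,
      [/\ gset_pow S N a,
          gset_pow S N b
        & paradoxical (affine_action R) [set 1%g; a; b] 4 [set: 'cV[R]_2]].
Proof.
(* g = g0^4 has length 16 and k has length 2, so g^d k has length at most
   7 * 16 + 2 = 114. *)
exists (114 + 70 * 16 + 114) => S _ SV S1 S_big S_fix.
have [g0 short_g0 tr_g0] := short_hyperbolic S1 SV S_big.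
pose g := (g0 ^+ 4)%g.
have short_g : short_word S 16 g := short_wordX S1 4 short_g0.
have tr_g : (47 <= \tr (theta g))%R := tr_fourth_power tr_g0.
have tr_g4 : (4 < \tr (theta g) ^+ 2)%R.
  by rewrite expr2; apply: (@lt_le_trans _ _ (47 * 47)%R) => //; rewrite ler_pM.
have [o o_rat go] := hyperbolic_fixed_point R tr_g4.
have [k short_k [k_axis ko]] : exists2 k, short_word S 2 k &
    ~ axis_stabilizer g k /\
    ~ [set h | affine_map h (map_mx ratr o : 'cV[R]_2) = map_mx ratr o] k.
  apply: short_outside => //.
  - exact: subgroup_axis_stabilizer.
  - exact: subgroup_fixing.
  - apply: contrapT => no.
    apply/S_big/(axis_stabilizer_virtually_solvable tr_g4).
    by move=> s Ss; apply: contrapT => Ns; apply: no; exists s.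
  - apply: contrapT => no; apply: S_fix; exists (map_mx ratr o); split=> //.
    apply: (generated_sub (subgroup_fixing _)) => s Ss.
    by apply: contrapT => Ns; apply: no; exists s.
have gk : (theta g *m theta k <> theta k *m theta g)%R.
  move=> e; apply: k_axis; left; rewrite conjgE.
  by rewrite (linear_part_comm e) mulKg.
have gk' : (theta g *m theta k <> theta k *m invmx (theta g))%R.
  move=> e; apply: k_axis; right; rewrite conjgE.
  have -> : (linear_part g * linear_part k =
      linear_part k * (linear_part g)^-1)%g.
    by rewrite -linear_partV -!linear_partM; apply: SA2Z_eq.
  by rewrite mulKg.
have conj_short n h : short_word S n h ->
    short_word S (n + 70 * 16 + n) (h * g ^+ 70 * h^-1)%g.
  move=> short_h; apply: short_wordM (short_wordV short_h).
  exact/(short_wordM short_h)/short_wordX.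
have [d [d7 par]] := eigenframe_paradoxical tr_g gk gk' go ko.
exists (axis_power g k d true), (axis_power g k d false); split=> //.
- suff [] : short_word S (114 + 70 * 16 + 114) (axis_power g k d true) by [].
  have : short_word S (2 + 70 * 16 + 2) (axis_power g k d true) :=
    conj_short _ _ short_k.
  exact: short_word_le.
have short_h : short_word S 114 (axis_conj g k d false).
  apply: (short_wordM (m := 112) (n := 2)) => //.
  apply: (short_word_le S1 (m := d * 16)); first by rewrite (leq_mul2r 16 d 7).
  exact: short_wordX.
by have [] := conj_short _ _ short_h.
Qed.
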